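(* Let $\mu$ be either a measure on $\mathbb{R}$ with bounded support or a measure on $\partial\mathbb{D}$. In the case of $\mathbb{R}$, let $\nu_n$ be the normalized zero counting measure of the degree-$n$ orthogonal polynomial of $\mu$; in the case of $\partial\mathbb{D}$, let $\nu_n$ be the normalized zero counting measure of a degree-$n$ paraorthogonal polynomial of $\mu$ (with an arbitrary choice of the parameter in $\partial\mathbb{D}$ for each $n$). Let $n(1)<n(2)<\cdots$ be a subsequence of the positive integers and let $\nu_\infty$ be a measure. Then, as $j\to\infty$, $\nu_{n(j)+1}\to\nu_\infty$ weakly if and only if $$\frac{1}{n(j)+1}\,K_{n(j)}(x,x)\,d\mu(x)\to d\nu_\infty \quad\text{weakly.}$$
   Context: $\partial\mathbb{D}=\{z\in\mathbb{C}:|z|=1\}$. Measures are positive, finite, not necessarily normalized, and have infinite support. For $\mu$ on $\mathbb{R}$: $p_n$ is the normalized orthogonal polynomial of degree $n$, and $K_n(x,y)=\sum_{j=0}^n p_j(x)p_j(y)$. For $\mu$ on $\partial\mathbb{D}$: $\Phi_n$ and $\varphi_n$ are the monic and normalized orthogonal polynomials of degree $n$, $\Phi_n^*(z)=z^n\,\overline{\Phi_n(1/\bar z)}$, and $K_n(z,w)=\sum_{j=0}^n\overline{\varphi_j(z)}\,\varphi_j(w)$ (so in the displayed formula $x$ runs over $\partial\mathbb{D}$ in this case). For $\beta\in\partial\mathbb{D}$ the paraorthogonal polynomial of degree $n+1$ is $P_{n+1}(z,\beta)=z\Phi_n(z)-\bar\beta\,\Phi_n^*(z)$; all its zeros lie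 on $\partial\mathbb{D}$. The normalized zero counting measure of a polynomial of degree $n$ is the probability measure giving each zero mass $1/n$ times its multiplicity. Weak convergence of measures means convergence of integrals of all bounded continuous functions (all measures here live on a fixed compact set). *)

(* Defs.v *)
From HB Require Import structures.
From mathcomp Require Import all_boot all_order all_algebra complex.
From mathcomp Require Import all_classical all_reals all_analysis.

Set Implicit Arguments.
Unset Strict Implicit.
Unset Printing Implicit Defensive.

Import Order.TTheory GRing.Theory Num.Theory.
Import numFieldNormedType.Exports.

Local Open Scope classical_set_scope.
Local Open Scope ring_scope.

Notation borelType T := (g_sigma_algebraType (@open T)).

(* R[i] carries no topology by itself; the regular module over the numFieldType
   R[i] has the one given by the modulus. *)
Notation cplx R := ((R[i])^o).

Section Borel_measures.
Context (R : realType) (T : ptopologicalType).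

Definition msupport (mu : set T -> \bar R) : set T :=
  [set x | forall U : set T, open U -> U x -> (0 < mu U)%E].

Definition weak_cvg (m : nat -> set (borelType T) -> \bar R)
    (l : set (borelType T) -> \bar R) : Prop :=
  forall f : T -> R, continuous f -> (exists M : R, forall x, `|f x| <= M) ->
    (\int[m j]_(x in [set: borelType T]) (f x)%:E)%E @[j --> \oo]
      --> (\int[l]_(x in [set: borelType T]) (f x)%:E)%E.

Definition density (mu : set (borelType T) -> \bar R) (f : T -> R) :
    set (borelType T) -> \bar R :=
  fun A => (\int[mu]_(x in A) (f x)%:E)%E.

End Borel_measures.

(* Only the zeros lying in the coefficient field [F] are counted. These are all
   the zeros for [F := R[i]], and also for [F := R] when [p] is an orthogonal
   polynomial of a measure on the real line. *)
Definition zero_counting (R : realType) (F : fieldType) (p : {poly F}) :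
    set F -> \bar R :=
  fun A => ((size p).-1%:R^-1 *
    \sum_(z \in [set z : F | root p z]) ((mup z p)%:R * (\1_A z : R)))%:E.

Section real_line.
Context (R : realType) (mu : {finite_measure set (borelType R) -> \bar R}).
Implicit Types (p q : {poly R}) (P : nat -> {poly R}).

Definition rdot p q : R := \int[mu]_(x in [set: borelType R]) (p.[x] * q.[x]).

Definition rnorm p : R := Num.sqrt (rdot p p).

Definition monic_OPRL P : Prop := forall n,
  [/\ P n \is monic, size (P n) = n.+1 &
      forall m, (m < n)%N -> rdot (P m) (P n) = 0].

Definition normalized_OPRL P (n : nat) : {poly R} := (rnorm (P n))^-1 *: P n.

Definition rCD P (n : nat) (x y : R) : R :=
  \sum_(j < n.+1) (normalized_OPRL P j).[x] * (normalized_OPRL P j).[y].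

End real_line.

Definition unit_circle (R : realType) : set (cplx R) :=
  [set z : R[i] | `|z| = 1].
Arguments unit_circle R : clear implicits.

Section reversed_polynomial.
Context (C : numClosedFieldType).
Implicit Types (p : {poly C}) (Phi : nat -> {poly C}).

(* [rev_poly n p] is z^n \overline{p(1/\bar z)}, see [horner_rev_poly]. *)
Definition rev_poly (n : nat) p : {poly C} := \poly_(k < n.+1) (p`_(n - k))^*.

Lemma horner_rev_poly (n : nat) p (z : C) : (size p <= n.+1)%N -> z != 0 ->
  (rev_poly n p).[z] = z ^+ n * (p.[(z^*)^-1])^*.
Proof.
move=> sp z0; rewrite /rev_poly horner_poly (horner_coef_wide _ sp).
rewrite rmorph_sum mulr_sumr (reindex_inj rev_ord_inj) /=.
apply: eq_bigr => -[k lek] _ /=; rewrite ltnS in lek; rewrite subSS subKn //.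
rewrite rmorphM rmorphXn fmorphV /= conjCK mulrCA; congr (_ * _).
by rewrite exprVn expfB_cond // (negbTE z0).
Qed.

(* The paraorthogonal polynomial of degree [n.+1] and parameter [b]. *)
Definition paraorthogonal Phi (n : nat) (b : C) : {poly C} :=
  'X * Phi n - b^* *: rev_poly n (Phi n).

End reversed_polynomial.

Section circle.
Context (R : realType) (mu : {finite_measure set (borelType (cplx R)) -> \bar R}).
Implicit Types (p q : {poly R[i]}) (Phi : nat -> {poly R[i]}).

Definition cintegral (f : R[i] -> R[i]) : R[i] :=
  ((\int[mu]_(z in [set: borelType (cplx R)]) complex.Re (f z)) +i*
   (\int[mu]_(z in [set: borelType (cplx R)]) complex.Im (f z)))%C.

Definition cdot p q : R[i] := cintegral (fun z => (p.[z])^* * q.[z]).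

(* [cdot p p] is real: it is the integral of |p|^2. *)
Definition cnorm p : R := Num.sqrt (complex.Re (cdot p p)).

Definition monic_OPUC Phi : Prop := forall n,
  [/\ Phi n \is monic, size (Phi n) = n.+1 &
      forall m, (m < n)%N -> cdot (Phi m) (Phi n) = 0].

Definition normalized_OPUC Phi (n : nat) : {poly R[i]} :=
  ((cnorm (Phi n))^-1)%:C%C *: Phi n.

Definition cCD Phi (n : nat) (z w : R[i]) : R[i] :=
  \sum_(j < n.+1) ((normalized_OPUC Phi j).[z])^* * (normalized_OPUC Phi j).[w].

End circle.

(* Main.v *)
From HB Require Import structures.
Require Import Defs.
From mathcomp Require Import all_boot all_order all_algebra complex.
From mathcomp Require Import all_classical all_reals all_analysis measurable_realfun ring.

Set Implicit Arguments.
Unset Strict Implicit.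
Unset Printing Implicit Defensive.

Import Order.TTheory GRing.Theory Num.Theory.
Import numFieldNormedType.Exports.

Local Open Scope classical_set_scope.
Local Open Scope ring_scope.

(** Write [Q] for the degree [n.+1] polynomial whose zeros are counted, [V] for
    the space of polynomials of degree at most [n] with the inner product of
    [L^2(mu)], and [P n] for the monic orthogonal polynomial of degree [n].

    The zeros [x] of [Q] are simple, and lie on the circle in the second case:
    otherwise [Q] would have a factor [(X - a)^2 + b^2], respectively
    [(X - z0)(X - 1/conj z0)], and the orthogonality of [Q] would make an
    integral of a positive function vanish (lemmas [OPRL_zeros] and
    [paraorthogonal_zeros]).

    The same orthogonality makes the node polynomials [l_x = Q / (X - x)]
    pairwise orthogonal, so after normalization they form an orthonormal basis
    [e_x] of [V].  The Christoffel-Darboux kernel on the diagonal does not depend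
    on the orthonormal basis, hence [K_n(y, y)] is the sum of the [|e_x(y)|^2]
    over the zeros.  As each [|e_x|^2 dmu] has mass one,

      sum_x f(x) - int f K_n dmu = sum_x int (f(x) - f(y)) |e_x(y)|^2 dmu(y).

    For continuous bounded [f] and [y] in the compact carrier of [mu],
    [|f(x) - f(y)| <= eps + C |x - y|^2], where [C] does not depend on
    [n].  Since [(y - x) e_x(y) = Q(y) / ||l_x||], the quadratic
    term contributes [C ||Q||^2 sum_x ||l_x||^-2].  The numbers [||l_x||^-1] are
    the coefficients of degree [n] of the [e_x], and their squares add up to the
    same value in any orthonormal basis, namely [||P n||^-2].  Finally
    [||Q||^2 / ||P n||^2] is at most [M^2] on the line ([mu] carried by [[-M, M]])
    and at most [4] on the circle.  So the difference above is at most
    [eps (n + 1) + C'] with [C'] independent of [n], and after division by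
    [n + 1] the two sequences of integrals have the same limits.

    Lemma [weak_cvg_counting_density] is the measure theoretic half of the
    argument, lemmas [node_poly_kernel] and [node_poly_leading] are the
    algebraic half; both halves are shared by the two cases. *)

(** * Integration of continuous functions against a measure with compact carrier *)

Section borel.
Context (R : realType) (T : ptopologicalType).

Lemma continuous_borel_measurable (f : T -> R) : continuous f ->
  measurable_fun [set: borelType T] (f : borelType T -> R).
Proof.
move=> cf mT.
apply: (measurability _ (RGenOInfty.measurableE R)) => //.
move=> _ [_ [a ->] <-]; rewrite setTI; apply: sub_sigma_algebra.
apply: open_comp => [x _|]; first exact: cf.
rewrite set_itvE; exact: open_gt.
Qed.

Context (mu : {finite_measure set (borelType T) -> \bar R}) (K : set T).
Hypotheses (cptK : compact K) (aeK : {ae mu, forall x, K x}).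

(** A continuous function is bounded on the compact carrier of a finite
    measure; it may well be unbounded on the whole space. *)
Lemma continuous_integrable (f : T -> R) : continuous f ->
  mu.-integrable [set: borelType T] (EFin \o f).
Proof.
move=> cf; have mf := continuous_borel_measurable cf.
have [M KM] : exists M : R, forall x, K x -> `|f x| <= M.
  have : compact (f @` K).
    by apply: continuous_compact => //; exact: continuous_subspaceT.
  move=> /compact_bounded[M [_ HM]]; exists (M + 1) => x Kx.
  by apply: (HM (M + 1)); [rewrite ltrDl | exists x].
apply/integrableP; split; first exact/measurable_EFinP.
apply: (@le_lt_trans _ _ (\int[mu]_(x in [set: borelType T]) (`|M|)%:E)%E).
  apply: ae_ge0_le_integral => //.
  - by do 2 apply: measurableT_comp => //.
  - apply: (@filterS _ _ (ae_filter_ringOfSetsType mu) _ _ _ aeK) => x /= Kx _.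
    rewrite lee_fin.
    exact: le_trans (KM _ Kx) (ler_norm _).
by rewrite integral_cst// ltey_eq fin_numM// fin_num_measure.
Qed.

Lemma Rintegral_ae_ge0 (f : T -> R) : continuous f ->
  (forall x, K x -> 0 <= f x) -> 0 <= \int[mu]_(x in [set: borelType T]) f x.
Proof.
move=> cf f0; rewrite /Rintegral.
have mf := continuous_borel_measurable cf.
rewrite (@ae_eq_integral _ _ _ mu _ (fun x : borelType T => `|f x|%:E))//.
- by rewrite fine_ge0// integral_ge0// => x _; rewrite lee_fin.
- exact/measurable_EFinP.
- by apply/measurable_EFinP; apply: measurableT_comp.
- apply: (@filterS _ _ (ae_filter_ringOfSetsType mu) _ _ _ aeK) => x /= Kx _.
  by rewrite ger0_norm// f0.
Qed.

Lemma ae_le_Rintegral (f g : T -> R) : continuous f -> continuous g ->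
  (forall x, K x -> f x <= g x) ->
  \int[mu]_(x in [set: borelType T]) f x <= \int[mu]_(x in [set: borelType T]) g x.
Proof.
move=> cf cg fg; rewrite -subr_ge0 -RintegralB//; try exact: continuous_integrable.
apply: (@Rintegral_ae_ge0 (fun x => g x - f x)).
  by move=> x; apply: cvgB; [exact: cg | exact: cf].
by move=> x /fg; rewrite subr_ge0.
Qed.

Lemma ae_eq_Rintegral (f g : T -> R) : continuous f -> continuous g ->
  (forall x, K x -> f x = g x) ->
  \int[mu]_(x in [set: borelType T]) f x = \int[mu]_(x in [set: borelType T]) g x.
Proof.
move=> cf cg fg; apply/eqP; rewrite eq_le !ae_le_Rintegral// => x Kx; rewrite fg//.
Qed.

Lemma continuous_sum (I : Type) (r : seq I) (f : I -> T -> R) :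
  (forall i, continuous (f i)) -> continuous (fun x => \sum_(i <- r) f i x).
Proof.
move=> cf; elim: r => [|i r IH].
  by under eq_fun do rewrite big_nil; move=> x; exact: cvg_cst.
by under eq_fun do rewrite big_cons; move=> x; apply: cvgD; [exact: cf|exact: IH].
Qed.

Lemma Rintegral_sum (I : Type) (r : seq I) (f : I -> T -> R) :
  (forall i, continuous (f i)) ->
  \int[mu]_(x in [set: borelType T]) (\sum_(i <- r) f i x) =
  \sum_(i <- r) \int[mu]_(x in [set: borelType T]) f i x.
Proof.
move=> cf; elim: r => [|i r IH].
  rewrite big_nil; under eq_Rintegral do rewrite big_nil.
  by rewrite Rintegral_cst// mul0r.
rewrite big_cons -IH -RintegralD//; first last.
- by apply: continuous_integrable; exact: continuous_sum.
- exact: continuous_integrable.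
by apply: eq_Rintegral => x _; rewrite big_cons.
Qed.


(** The density is the Radon-Nikodym derivative of [density mu g], by
    almost-everywhere uniqueness, and this reduces the claim to the change of
    variables for such derivatives. *)
Lemma integral_density (g f : T -> R) : continuous g -> (forall x, 0 <= g x) ->
  continuous f -> (exists M : R, forall x, `|f x| <= M) ->
  (\int[density mu g]_(x in [set: borelType T]) (f x)%:E =
   \int[mu]_(x in [set: borelType T]) (f x * g x)%:E)%E.
Proof.
move=> cg g0 cf [M fM].
have ig := continuous_integrable cg.
have mg : measurable_fun [set: borelType T] (EFin \o g).
  by apply/measurable_EFinP; exact: continuous_borel_measurable.
have mf : measurable_fun [set: borelType T] (EFin \o f).
  by apply/measurable_EFinP; exact: continuous_borel_measurable.
have d0 : density mu g set0 = 0%E by rewrite /density integral_set0.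
have dge0 A : (0 <= density mu g A)%E.
  by apply: integral_ge0 => x _; rewrite lee_fin.
have dsa : semi_sigma_additive (density mu g).
  by apply: semi_sigma_additive_nng_induced => // x; rewrite lee_fin.
have dfin : fin_num_fun (density mu g).
  move=> A mA; apply: integrable_fin_num => //.
  exact: integrableS ig.
pose nu0 := isMeasure.Build _ _ _ (density mu g) d0 dge0 dsa.
pose nu1 : {measure set (borelType T) -> \bar R} := HB.pack (density mu g) nu0.
pose nu2 := @Measure_isFinite.Build _ _ _ nu1 dfin.
pose nu : {finite_measure set (borelType T) -> \bar R} :=
  HB.pack (density mu g) nu0 nu2.
have nuE : (nu : set (borelType T) -> \bar R) = density mu g by [].
have numu : nu `<< mu.
  apply/null_content_dominatesP => A mA muA; rewrite nuE /density.
  by apply: null_set_integral => //; apply: measurable_funTS.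
have fint : nu.-integrable [set: borelType T] (EFin \o f).
  apply: measurable_bounded_integrable => //.
  - by have := dfin _ measurableT; rewrite ge0_fin_numE.
  - exact/measurable_EFinP.
  - exists M; split; first exact: num_real.
    by move=> x Mx y _; exact: le_trans (fM y) (ltW Mx).
rewrite -nuE -(Radon_Nikodym_change_of_variables numu measurableT fint).
apply: ae_eq_integral => //.
- by apply: emeasurable_funM => //; apply: measurable_int; exact: Radon_Nikodym_integrable.
- by apply: (emeasurable_funM mf mg).
apply: (@ae_eqe_mul2l _ _ _ mu _ _ (EFin \o g) (EFin \o f)).
apply: integral_ae_eq => //; first exact: Radon_Nikodym_integrable.
by move=> E _ mE; rewrite -Radon_Nikodym_integral.
Qed.
End borel.

(** * Weak limits of point counts and of densities *)

Section atomic.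
Context (R : realType) (T : ptopologicalType).

Definition normalized_counting (s : seq T) : set (borelType T) -> \bar R :=
  fun A => ((size s)%:R^-1 * \sum_(x <- s) \1_A x)%:E.

(** [normalized_counting s] is a scaled finite sum of Dirac masses.  The
    integral is additive in the measure for nonnegative integrands, whence the
    split into the positive and the negative part of [f]. *)
Lemma integral_normalized_counting (s : seq T) (f : T -> R) : continuous f ->
  (\int[normalized_counting s]_(x in [set: borelType T]) (f x)%:E =
   ((size s)%:R^-1 * \sum_(x <- s) f x)%:E)%E.
Proof.
move=> cf.
have mf : measurable_fun [set: borelType T] (EFin \o f).
  by apply/measurable_EFinP; exact: continuous_borel_measurable.
pose pt k : borelType T := nth point s k.
have N0 : 0 <= (size s)%:R^-1 :> R by rewrite invr_ge0.
pose m : {measure set (borelType T) -> \bar R} :=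
  mscale (NngNum N0) (msum (fun k => dirac (pt k)) (size s)).
have mE : normalized_counting s = m.
  apply/funext => A; rewrite /m /= /mscale /= /msum /= sumEFin.
  rewrite /normalized_counting (big_nth point) big_mkord -EFinM.
  by congr (_ * _)%:E; apply: eq_bigr => i _; rewrite /dirac.
have ge0int (g : borelType T -> \bar R) : measurable_fun setT g ->
    (forall x, 0 <= g x)%E ->
    (\int[m]_(x in setT) g x =
      (size s)%:R^-1%:E * \sum_(k < size s) g (pt k))%E.
  move=> mg g0; rewrite ge0_integral_mscale// ge0_integral_measure_sum//.
  congr (_ * _)%E; apply: eq_bigr => k _.
  by rewrite integral_dirac// diracT mul1e.
rewrite mE integralE ge0int//; last exact: measurable_funepos.
rewrite ge0int//; last exact: measurable_funeneg.
rewrite (big_nth point) big_mkord.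
have fpE x : ((fun x => (f x)%:E)^\+ x = (Num.max (f x) 0)%:E)%E.
  by rewrite funeposE EFin_max.
have fnE x : ((fun x => (f x)%:E)^\- x = (Num.max (- f x) 0)%:E)%E.
  by rewrite funenegE EFin_max.
under eq_bigr do rewrite fpE.
under [X in (_ - _ * X)%E]eq_bigr do rewrite fnE.
rewrite !sumEFin -!EFinM -EFinB -mulrBr -sumrB; congr (_ * _)%:E.
apply: eq_bigr => i _; rewrite /pt.
have [h|/ltW h] := lerP 0 (f (nth point s i)).
  by rewrite max_r ?oppr_le0// subr0.
by rewrite max_l ?oppr_ge0// sub0r opprK.
Qed.

End atomic.

Lemma cvg_EFin_vanishing_diff (R : realType) (a b : nat -> R) (l : \bar R) :
  a j - b j @[j --> \oo] --> 0 ->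
  (b j)%:E @[j --> \oo] --> l -> (a j)%:E @[j --> \oo] --> l.
Proof.
move=> ab bl; rewrite -[l]adde0.
have -> : (fun j => (a j)%:E) = (fun j => (b j)%:E + (a j - b j)%:E)%E.
  by apply/funext => j; rewrite -EFinD addrC subrK.
apply: cvgeD => //; first by rewrite fin_num_adde_defl.
by apply: cvg_EFin ab; exact: nearW.
Qed.

Section localized_weights.
Context (R : realType) (T : ptopologicalType).
Context (mu : {finite_measure set (borelType T) -> \bar R}) (K : set T).
Hypotheses (cptK : compact K) (aeK : {ae mu, forall x, K x}).
Context (D : T -> T -> R).
Hypothesis D_cont : forall x, continuous (D x).
Local Notation E f := (Rintegral mu [set: borelType T] f).

(** Each weight has mass one, so [f x] is the integral of the constant [f x]
    against [w x]; the bound is then the one on [f x - f y], integrated. *)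
Lemma localized_sum_integral (s : seq T) (w : T -> T -> R) (f : T -> R)
    (e C : R) :
  (forall x, continuous (w x)) -> (forall x y, 0 <= w x y) ->
  (forall x, x \in s -> E (w x) = 1) -> continuous f ->
  (forall x y, K y -> `|f x - f y| <= e + C * D x y ^+ 2) ->
  `|\sum_(x <- s) f x - E (fun y => f y * \sum_(x <- s) w x y)| <=
    e * (size s)%:R + C * \sum_(x <- s) E (fun y => D x y ^+ 2 * w x y).
Proof.
move=> cw w0 w1 cf fD.
have cfw x : continuous (fun y => f y * w x y).
  by move=> y; apply: cvgM; [exact: cf | exact: cw].
have cDw x : continuous (fun y => D x y ^+ 2 * w x y).
  move=> y; apply: cvgM; last exact: cw.
  by rewrite expr2; apply: cvgM; exact: D_cont.
have cxw x (a : R) : continuous (fun y => a * w x y).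
  by move=> y; apply: cvgM; [exact: cvg_cst | exact: cw].
have cI g : continuous g -> mu.-integrable [set: borelType T] (EFin \o g).
  by move=> cg; exact: (continuous_integrable cptK aeK cg).
have -> : E (fun y => f y * \sum_(x <- s) w x y) =
    \sum_(x <- s) E (fun y => f y * w x y).
  rewrite -(Rintegral_sum cptK aeK _ cfw); apply: eq_Rintegral => y _.
  by rewrite mulr_sumr.
rewrite -sumrB; apply: le_trans (ler_norm_sum _ _ _) _.
rewrite mulr_sumr -sum1_size natr_sum mulr_sumr -big_split /=.
rewrite big_seq [leRHS]big_seq; apply: ler_sum => x xs.
have -> : f x - E (fun y => f y * w x y) = E (fun y => (f x - f y) * w x y).
  under [in RHS]eq_Rintegral do rewrite mulrBl.
  rewrite RintegralB//; [|exact: cI..].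
  by rewrite RintegralZl ?w1 ?mulr1//; exact: cI.
have cg : continuous (fun y => (f x - f y) * w x y).
  move=> y; apply: cvgM; last exact: cw.
  by apply: cvgB; [exact: cvg_cst | exact: cf].
apply: le_trans (le_normr_Rintegral _ _) _ => //; first exact: cI.
rewrite mulr1 -[e in leRHS]mulr1 -(w1 _ xs) -RintegralZl//; last exact: cI.
rewrite -RintegralZl//; last exact: cI.
have cCD : continuous (fun y => C * (D x y ^+ 2 * w x y)).
  by move=> y; apply: cvgM; [exact: cvg_cst | exact: cDw].
rewrite -RintegralD//; [|exact: cI..].
apply: (ae_le_Rintegral cptK aeK) => //.
- by move=> y; apply: cvg_norm; exact: cg.
- by move=> y; apply: cvgD; [exact: cxw | exact: cCD].
move=> y Ky; rewrite normrM (ger0_norm (w0 x y)) mulrA -mulrDl.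
by rewrite ler_wpM2r// fD.
Qed.

Hypothesis D_unif : forall f : T -> R, continuous f -> forall e : R, 0 < e ->
  exists2 d : R, 0 < d & forall x y, K y -> D x y < d -> `|f x - f y| < e.

(** The second moments of the weights stay bounded in total while the number
    of points grows: on average each weight concentrates at its point, and the
    integrals of a test function against the two sequences differ by at most
    [e / 2 + C * B / (n j).+1]. *)
Lemma weak_cvg_counting_density (n : nat -> nat) (s : nat -> seq T)
    (w : nat -> T -> T -> R) (B : R) (l : set (borelType T) -> \bar R) :
  {homo n : i j / (i < j)%N} ->
  (forall k, size (s k) = k.+1) ->
  (forall k x, continuous (w k x)) -> (forall k x y, 0 <= w k x y) ->
  (forall k x, x \in s k -> E (w k x) = 1) ->
  (forall k, \sum_(x <- s k) E (fun y => D x y ^+ 2 * w k x y) <= B) ->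
  weak_cvg (fun j => normalized_counting R (s (n j))) l <->
  weak_cvg (fun j => density mu
    (fun y => (n j).+1%:R^-1 * \sum_(x <- s (n j)) w (n j) x y)) l.
Proof.
move=> n_incr ss cw w0 w1 wS.
suff key (f : T -> R) : continuous f -> (exists M : R, forall x, `|f x| <= M) ->
  exists2 a : nat -> R,
   (fun j => \int[normalized_counting R (s (n j))]_(x in [set: borelType T])
      (f x)%:E)%E = EFin \o a & exists2 b : nat -> R,
   (fun j => \int[density mu (fun y => (n j).+1%:R^-1 *
      \sum_(x <- s (n j)) w (n j) x y)%R]_(x in [set: borelType T])
      (f x)%:E)%E = EFin \o b & (a j - b j @[j --> \oo] --> 0).
  split=> cv f cf fM; have [a aE [b bE ab0]] := key f cf fM.
    rewrite bE; apply: (cvg_EFin_vanishing_diff (b := a)).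
      rewrite -oppr0; under eq_fun do rewrite -opprB; exact: cvgN.
    by have := cv f cf fM; rewrite aE.
  rewrite aE; apply: (cvg_EFin_vanishing_diff ab0).
  by have := cv f cf fM; rewrite bE.
move=> cf [M fM].
pose k j y := \sum_(x <- s (n j)) w (n j) x y.
have ck j : continuous (k j) by exact: continuous_sum.
have cfk j : continuous (fun y => f y * k j y).
  by move=> y; apply: cvgM; [exact: cf | exact: ck].
exists (fun j => (n j).+1%:R^-1 * \sum_(x <- s (n j)) f x).
  by apply/funext => j /=; rewrite integral_normalized_counting// ss.
exists (fun j => (n j).+1%:R^-1 * E (fun y => f y * k j y)).
  apply/funext => j /=; rewrite (integral_density cptK aeK)//; first last.
  - by exists M.
  - by move=> y; rewrite mulr_ge0 ?invr_ge0// sumr_ge0.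
  - by move=> y; apply: cvgM; [exact: cvg_cst | exact: ck].
  rewrite -RintegralZl//; last exact: (continuous_integrable cptK aeK).
  rewrite /Rintegral fineK; last first.
    apply: integrable_fin_num => //; apply: (continuous_integrable cptK aeK).
    by move=> y; apply: cvgM; [exact: cvg_cst | exact: cfk].
  by apply: eq_integral => y _; rewrite mulrCA.
apply/cvgr0Pnorm_le => e e0.
have e2 : 0 < e / 2 by rewrite divr_gt0.
have [d d0 dP] := D_unif cf e2.
have M0 : 0 <= M by exact: le_trans (normr_ge0 _) (fM point).
(* chosen so that [2 * M <= C * D x y ^+ 2] as soon as [d <= D x y] *)
pose C := 2 * M / d ^+ 2.
have C0 : 0 <= C by rewrite divr_ge0 ?sqr_ge0// mulr_ge0.
have fC x y : K y -> `|f x - f y| <= e / 2 + C * D x y ^+ 2.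
  move=> Ky; have [Dd|dD] := ltP (D x y) d.
    apply: le_trans (ltW (dP x y Ky Dd)) _.
    by rewrite lerDl mulr_ge0// sqr_ge0.
  apply: (@le_trans _ _ (2 * M)).
    by rewrite mulr_natl mulr2n (le_trans (ler_normB _ _))// lerD.
  apply: (@le_trans _ _ (C * d ^+ 2)).
    by rewrite divfK// expf_neq0// gt_eqF.
  rewrite -[leLHS]add0r lerD ?(ltW e2)// ler_wpM2l// lerXn2r// nnegrE ltW//.
  exact: lt_le_trans dD.
near=> j.
rewrite -mulrBr normrM ger0_norm ?invr_ge0// ler_pdivrMl//.
have := localized_sum_integral (cw (n j)) (w0 (n j)) (w1 (n j)) cf fC.
move=> /le_trans; apply; rewrite ss.
apply: (@le_trans _ _ (e / 2 * (n j).+1%:R + C * B)).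
  by rewrite lerD2l ler_wpM2l.
rewrite [leRHS]mulrC [X in _ <= X * _]splitr mulrDl lerD2l.
rewrite mulrC -ler_pdivrMl// mulrC.
have jn i : (i <= n i)%N.
  by elim: i => // i IH; apply: leq_ltn_trans IH (n_incr _ _ (ltnSn i)).
apply: (@le_trans _ _ j%:R); last by rewrite ler_nat (leq_trans (jn j)).
near: j; exact: nbhs_infty_ger.
Unshelve. all: by end_near. Qed.

End localized_weights.

(** Uniform continuity near a compact set, where only one of the two points is
    required to lie in it: zeros of orthogonal polynomials need not belong to
    the carrier of the measure.  The distance is an abstract real-valued function so
    that the modulus on the complex numbers qualifies, whose pseudometric
    structure has complex radii. *)
Lemma compact_uniform_continuity (R : realType) (T : topologicalType) (K : set T)
    (D : T -> T -> R) (f : T -> R) (e : R) :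
  compact K ->
  (forall x y z, D x z <= D x y + D y z) ->
  (forall y U, nbhs y U -> exists2 d, 0 < d & forall x, D x y < d -> U x) ->
  (forall y d, 0 < d -> \forall y' \near y, D y' y < d) ->
  (forall x y, D x y = D y x) ->
  continuous f -> 0 < e ->
  exists2 d : R, 0 < d & forall x y, K y -> D x y < d -> `|f x - f y| < e.
Proof.
move=> /compact_near_coveringP cK Dtri Dball Dnbhs Dsym cf e0.
have H : \forall d \near 0^'+, K `<=`
    (fun y => forall x, D x y < d -> `|f x - f y| < e).
  apply: cK => y Ky.
  have e2 : 0 < e / 2 by rewrite divr_gt0.
  have /Dball[d d0 dP] : nbhs y [set x | `|f y - f x| < e / 2].
    by move/cvgrPdist_lt : (cf y) => /(_ _ e2).
  have d2 : 0 < d / 2 by rewrite divr_gt0.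
  exists ([set y' | D y' y < d / 2], [set r | 0 < r < d / 2]) => /=.
    split; first exact: Dnbhs.
    near=> r; apply/andP; split; first by near: r; exact: nbhs_right_gt.
    by near: r; exact: nbhs_right_lt.
  move=> [y' r] /= [y'y /andP[r0 rd]] x xy'.
  have h1 : `|f y - f y'| < e / 2.
    by apply: dP; apply: lt_trans y'y _; rewrite ltr_pdivrMr// ltr_pMr// ltr1n.
  have h2 : `|f y - f x| < e / 2.
    apply: dP; apply: le_lt_trans (Dtri _ y' _) _.
    by rewrite [ltRHS]splitr ltrD// (lt_trans xy').
  rewrite distrC in h2.
  have -> : f x - f y' = (f x - f y) + (f y - f y') by rewrite addrA subrK.
  by rewrite [ltRHS]splitr (le_lt_trans (ler_normD _ _))// ltrD.
have [d [d0 dP]] : exists d : R, 0 < d /\ K `<=`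
    (fun y => forall x, D x y < d -> `|f x - f y| < e).
  near (0 : R)^'+ => d; exists d; split; first by near: d; exact: nbhs_right_gt.
  by near: d.
by exists d => // x y Ky; exact: dP.
Unshelve. all: by end_near. Qed.

(** * Supports, and counting simple zeros *)

Lemma zero_counting_simple (R : realType) (F : fieldType) (s : seq F) (A : set F) :
  uniq s ->
  zero_counting R (\prod_(x <- s) ('X - x%:P)) A =
  ((size s)%:R^-1 * \sum_(x <- s) \1_A x)%:E.
Proof.
move=> us; rewrite /zero_counting size_prod_XsubC /=; congr (_ * _)%:E.
have -> : [set z : F | root (\prod_(x <- s) ('X - x%:P)) z] = [set` s].
  by apply/seteqP; split => z /=; rewrite root_prod_XsubC.
rewrite -fsbig_seq// big_seq [RHS]big_seq; apply: eq_bigr => x xs.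
suff -> : mup x (\prod_(x <- s) ('X - x%:P)) = 1%N by rewrite mul1r.
rewrite (big_rem x xs) /= mupMl; last first.
  by rewrite root_prod_XsubC mem_rem_uniq// !inE eqxx.
by rewrite -['X - _]expr1 mup_XsubCX eqxx.
Qed.

Lemma infinite_set_nonroot (F : fieldType) (A : set F) (p : {poly F}) :
  infinite_set A -> p != 0 -> exists2 x, A x & p.[x] != 0.
Proof.
move=> /(infinite_set_fset (size p))[B BA sB] p0; apply: contrapT => nex.
suff rB : all (root p) (finmap.enum_fset B).
  by have := max_poly_roots p0 rB (finmap.fset_uniq B); rewrite ltnNge sB.
apply/allP => x xB; apply: contrapT => /negP px; apply: nex.
by exists x; [exact: BA | exact: px].
Qed.

Section support.
Context (R : realType) (T : ptopologicalType).
Context (mu : {finite_measure set (borelType T) -> \bar R}) (K : set T).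
Hypotheses (cptK : compact K) (aeK : {ae mu, forall x, K x}).

Lemma open_borel_measurable (U : set T) : open U -> measurable (U : set (borelType T)).
Proof. exact: sub_sigma_algebra. Qed.

(** The function exceeds half of its value at [x] on a neighbourhood of [x],
    which has positive measure. *)
Lemma Rintegral_gt0_support (g : T -> R) x : continuous g ->
  (forall y, 0 <= g y) -> msupport mu x -> 0 < g x ->
  0 < \int[mu]_(y in [set: borelType T]) g y.
Proof.
move=> cg g0 mux gx.
have ig := continuous_integrable cptK aeK cg.
pose U : set T := g @^-1` [set r | g x / 2 < r].
have oU : open U by apply: open_comp; [move=> y _; exact: cg | exact: open_gt].
have Ux : U x by rewrite /U /= ltr_pdivrMr// ltr_pMr// ltr1n.
have muU := mux _ oU Ux.
rewrite /Rintegral; apply: fine_gt0; apply/andP; split; last first.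
  rewrite -ge0_fin_numE; first exact: integrable_fin_num.
  by apply: integral_ge0 => y _; rewrite lee_fin.
have mU := open_borel_measurable oU.
have mg : measurable_fun [set: borelType T] (EFin \o g).
  by apply/measurable_EFinP; exact: continuous_borel_measurable.
apply: (@lt_le_trans _ _ (\int[mu]_(y in (U : set (borelType T))) (g x / 2)%:E)%E).
  by rewrite integral_cst// mule_gt0// lte_fin divr_gt0.
apply: (@le_trans _ _ (\int[mu]_(y in (U : set (borelType T))) (g y)%:E)%E).
  apply: ge0_le_integral => //.
  - by move=> y _; rewrite lee_fin divr_ge0// ltW.
  - exact: measurable_funTS.
  - by move=> y Uy; rewrite lee_fin ltW.
by apply: ge0_subset_integral => // y _; rewrite lee_fin.
Qed.

End support.

(** The complement of the support is null: it is covered by the null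
    intervals with rational end points, of which there are countably many. *)
Lemma ae_bounded_of_msupport (R : realType)
    (mu : {finite_measure set (borelType R) -> \bar R}) :
  bounded_set (msupport mu) ->
  exists2 M : R, 0 < M & {ae mu, forall x, `[- M, M]%classic x}.
Proof.
move=> [M0 [_ HM]]; pose M := `|M0| + 1.
have suppM x : msupport mu x -> `|x| <= M.
  by apply: HM; rewrite (le_lt_trans (ler_norm _))// ltrDl.
exists M; first by rewrite ltr_wpDl.
pose I (q : rat * rat) : set R := `](ratr q.1), (ratr q.2)[%classic.
have mI q : measurable (I q : set (borelType R)).
  by apply: open_borel_measurable; exact: interval_open.
pose J k := if unpickle k is Some q then
  (if mu (I q) == 0%E then I q else set0) else set0.
apply: (@negligibleS _ _ _ mu (\bigcup_k J k : set (borelType R))).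
  move=> x /= xM.
  have : ~ msupport mu x.
    by move=> /suppM; rewrite ler_norml => h; apply: xM; rewrite in_itv.
  move=> /existsNP[U /not_implyP[oU /not_implyP[Ux muU]]].
  have /nbhs_ballP[e /= e0 eU] : nbhs x U by exact: open_nbhs_nbhs.
  have xe1 : x - e < x by rewrite ltrBlDr ltrDl.
  have xe2 : x < x + e by rewrite ltrDl.
  have [q1] := rat_in_itvoo xe1.
  rewrite in_itv /= => /andP[a1 a2].
  have [q2] := rat_in_itvoo xe2.
  rewrite in_itv /= => /andP[a3 a4].
  have IU : I (q1, q2) `<=` U.
    move=> y; rewrite /I /= in_itv /= => /andP[y1 y2]; apply: eU.
    rewrite /ball /= ltr_distlC; apply/andP; split.
      exact: lt_trans y1.
    exact: lt_trans a4.
  have muI : mu (I (q1, q2)) = 0%E.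
    apply/eqP; rewrite eq_le measure_ge0 andbT.
    apply: (@le_trans _ _ (mu U)); last by rewrite leNgt; apply/negP.
    by apply: le_measure => //; rewrite inE; [exact: mI|exact: open_borel_measurable].
  exists (pickle (q1, q2)); first exact: Logic.I.
  rewrite /J pickleK muI eqxx /I; apply/andP; split; first exact: a2.
  exact: a3.
apply: negligible_bigcup => k; rewrite /J.
case: unpickle => [q|]; last exact: negligible_set0.
case: ifPn => [/eqP muq|_]; last exact: negligible_set0.
by apply/negligibleP.
Qed.

(** * Orthonormal bases of polynomials and node polynomials *)

Section monic_basis.
Context (F : fieldType) (P : nat -> {poly F}).
Hypotheses (P_monic : forall k, P k \is monic) (P_size : forall k, size (P k) = k.+1).

(** Subtracting the right multiple of [P m] lowers the degree. *)
Lemma monic_basis m (q : {poly F}) : (size q <= m)%N ->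
  exists c : 'I_m -> F, q = \sum_(k < m) c k *: P k.
Proof.
elim: m q => [|m IH] q sq.
  by exists (fun=> 0); rewrite big_ord0; apply/eqP; rewrite -size_poly_leq0.
have [|c cE] := IH (q - q`_m *: P m).
  apply/leq_sizeP => j; rewrite leq_eqVlt => /orP[/eqP <-|mj].
    have := P_monic m; rewrite monicE lead_coefE P_size /= => /eqP PE.
    by rewrite coefB coefZ PE mulr1 subrr.
  rewrite coefB coefZ (nth_default _ (leq_trans sq mj)).
  by rewrite (nth_default _ (_ : size (P m) <= j)%N) ?P_size// mulr0 subr0.
exists (fun k => if unlift ord_max k is Some k' then c k' else q`_m).
rewrite big_ord_recr /= unlift_none -[q in LHS](subrK (q`_m *: P m)) cE.
congr (_ + _); apply: eq_bigr => k _.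
have -> : widen_ord (leqnSn m) k = lift ord_max k.
  by apply: val_inj; rewrite /= /bump leqNgt ltn_ord.
by rewrite liftK.
Qed.

End monic_basis.

Section sesquilinear.
Context (F : fieldType) (cj : {rmorphism F -> F}).
Context (dot : {poly F} -> {poly F} -> F).
Hypothesis dot_linear : forall p a q r, dot p (a *: q + r) = a * dot p q + dot p r.
Hypothesis dotC : forall p q, dot q p = cj (dot p q).

Lemma dot0r p : dot p 0 = 0.
Proof. by have := dot_linear p (-1) 0 0; rewrite scaler0 addr0 mulN1r addNr. Qed.

Lemma dotDr p q r : dot p (q + r) = dot p q + dot p r.
Proof. by rewrite -[q]scale1r dot_linear mul1r scale1r. Qed.

Lemma dotZr p a q : dot p (a *: q) = a * dot p q.
Proof. by rewrite -[a *: q]addr0 dot_linear dot0r addr0. Qed.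

Lemma dotBr p q r : dot p (q - r) = dot p q - dot p r.
Proof. by rewrite -scaleN1r dotDr dotZr mulN1r. Qed.

Lemma dot0l p : dot 0 p = 0.
Proof. by rewrite dotC dot0r rmorph0. Qed.

Lemma dotDl p q r : dot (q + r) p = dot q p + dot r p.
Proof. by rewrite dotC dotDr rmorphD/= -!dotC. Qed.

Lemma dotZl p a q : dot (a *: q) p = cj a * dot q p.
Proof. by rewrite dotC dotZr rmorphM/= -dotC. Qed.

Lemma dot_suml (I : Type) (r : seq I) (f : I -> {poly F}) p :
  dot (\sum_(i <- r) f i) p = \sum_(i <- r) dot (f i) p.
Proof. by elim/big_rec2 : _ => [|i x y _ <-]; rewrite ?dot0l ?dotDl. Qed.

Lemma dot_sumr (I : Type) (r : seq I) (f : I -> {poly F}) p :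
  dot p (\sum_(i <- r) f i) = \sum_(i <- r) dot p (f i).
Proof. by elim/big_rec2 : _ => [|i x y _ <-]; rewrite ?dot0r ?dotDr. Qed.

(** Parseval for a linear form on a finite-dimensional space: the transition
    matrix satisfies [M M^* = 1], hence [M^* M = 1] because it is square, and
    therefore preserves the sum of the squared moduli of the values of [L].  With
    [cj := idfun] this is the real case. *)
Lemma orthonormal_change (N : nat) (p e : 'I_N -> {poly F}) (A : 'I_N -> 'I_N -> F)
    (L : {linear {poly F} -> F | *%R}) :
  (forall i, e i = \sum_j A i j *: p j) ->
  (forall i j, dot (p i) (p j) = (i == j)%:R) ->
  (forall i j, dot (e i) (e j) = (i == j)%:R) ->
  \sum_i cj (L (e i)) * L (e i) = \sum_j cj (L (p j)) * L (p j).
Proof.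
move=> eE pp ee.
pose M : 'M[F]_N := \matrix_(i, j) A i j.
have dotee i k : dot (e k) (e i) = \sum_j A i j * cj (A k j).
  rewrite [e k]eE dot_suml; apply: eq_bigr => j _.
  rewrite dotZl [e i]eE dot_sumr (bigD1 j)//= dotZr pp eqxx mulr1.
  rewrite big1 ?addr0 1?mulrC// => l lj.
  by rewrite dotZr pp eq_sym (negbTE lj) mulr0.
have MM : M *m (map_mx cj M)^T = 1%:M.
  apply/matrixP => i k; rewrite !mxE eq_sym -ee dotee.
  by apply: eq_bigr => j _; rewrite !mxE.
have MM' := mulmx1C MM.
pose v : 'cV[F]_N := \col_j L (p j).
have uE : (\col_i L (e i)) = M *m v.
  apply/matrixP => i k; rewrite !mxE eE linear_sum; apply: eq_bigr => j _.
  by rewrite !mxE linearZ.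
have hE (u : 'cV[F]_N) : \sum_i cj (u i 0) * u i 0 = ((map_mx cj u)^T *m u) 0 0.
  by rewrite mxE; apply: eq_bigr => i _; rewrite !mxE.
transitivity (\sum_i cj ((M *m v) i 0) * (M *m v) i 0).
  by apply: eq_bigr => i _; rewrite -uE mxE.
rewrite hE map_mxM trmx_mul mulmxA -(mulmxA _ _ M) MM' mulmx1 -hE.
by apply: eq_bigr => j _; rewrite mxE.
Qed.

Context (nrm : {poly F} -> F).
Hypothesis nrm_neq0 : forall p, p != 0 -> nrm p != 0.
Hypothesis nrm_cj : forall p, cj (nrm p) = nrm p.
Hypothesis nrm_sqr : forall p, nrm p ^+ 2 = dot p p.

Definition normalized (p : {poly F}) : {poly F} := (nrm p)^-1 *: p.

Lemma dot_normalized p q : dot (normalized p) (normalized q) =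
  (nrm p * nrm q)^-1 * dot p q.
Proof. by rewrite dotZl dotZr fmorphV nrm_cj invfM mulrA. Qed.

Lemma dot_normalizedE p : p != 0 -> dot (normalized p) (normalized p) = 1.
Proof.
move=> p0; rewrite dot_normalized -expr2 nrm_sqr mulVf// -nrm_sqr expf_neq0//.
exact: nrm_neq0.
Qed.

Context (P : nat -> {poly F}).
Hypotheses (P_monic : forall k, P k \is monic) (P_size : forall k, size (P k) = k.+1).
Hypothesis P_orth : forall m n, (m < n)%N -> dot (P m) (P n) = 0.

Lemma dot_orthogonal_lower m (q : {poly F}) : (size q <= m)%N -> dot q (P m) = 0.
Proof.
move=> /(monic_basis P_monic P_size)[c ->]; rewrite dot_suml big1// => k _.
by rewrite dotZl P_orth ?mulr0.
Qed.

(** Up to a constant, the Lagrange interpolation polynomial at the zero [x] of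
    [Q]. *)
Definition node_poly (Q : {poly F}) (x : F) : {poly F} := Q %/ ('X - x%:P).

Lemma node_polyK (Q : {poly F}) x : root Q x -> Q = ('X - x%:P) * node_poly Q x.
Proof. by move=> Qx; rewrite mulrC divpK// dvdp_XsubCl. Qed.

Lemma node_poly_monic (Q : {poly F}) x : Q \is monic -> root Q x ->
  node_poly Q x \is monic.
Proof. by move=> Qm Qx; rewrite -(monicMl _ (monicXsubC x)) -node_polyK. Qed.

Lemma size_node_poly (Q : {poly F}) x : size (node_poly Q x) = (size Q).-1.
Proof. by rewrite size_divp ?polyXsubC_eq0// size_XsubC subn1. Qed.

(** The normalized node polynomials form an orthonormal basis of the
    polynomials of degree at most [m].  For [L] the evaluation at a point, this
    writes the Christoffel-Darboux kernel on the diagonal as a sum over the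
    zeros of [Q]. *)
Lemma node_poly_kernel (m : nat) (Q : {poly F}) (s : seq F)
    (L : {linear {poly F} -> F | *%R}) :
  Q \is monic -> size Q = m.+2 -> uniq s -> size s = m.+1 -> all (root Q) s ->
  (forall x y, x \in s -> y \in s -> x != y ->
    dot (node_poly Q x) (node_poly Q y) = 0) ->
  \sum_(x <- s) cj (L (normalized (node_poly Q x))) * L (normalized (node_poly Q x)) =
  \sum_(j < m.+1) cj (L (normalized (P j))) * L (normalized (P j)).
Proof.
move=> Qm Qs us ss /allP sQ orth.
have nm x : x \in s -> node_poly Q x != 0.
  by move=> /sQ Qx; apply: monic_neq0; exact: node_poly_monic.
pose x_ (i : 'I_m.+1) := nth 0 s i.
have xs i : x_ i \in s by rewrite mem_nth// ss.
rewrite (big_nth 0) ss big_mkord.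
have [A AE] : exists A : 'I_m.+1 -> 'I_m.+1 -> F, forall i,
    normalized (node_poly Q (x_ i)) = \sum_j A i j *: normalized (P j).
  have [A AE] : {A : 'I_m.+1 -> 'I_m.+1 -> F & forall i,
      normalized (node_poly Q (x_ i)) = \sum_j A i j *: P j}.
    apply: (@choice _ _ (fun i (a : 'I_m.+1 -> F) =>
      normalized (node_poly Q (x_ i)) = \sum_j a j *: P j)) => i.
    apply: monic_basis => //.
    by rewrite (leq_trans (size_scale_leq _ _))// size_node_poly Qs.
  exists (fun i j => A i j * nrm (P j)) => i; rewrite AE.
  apply: eq_bigr => j _; rewrite scalerA mulfK//.
  by rewrite nrm_neq0// monic_neq0.
apply: (orthonormal_change _ AE).
- move=> i j; have [<-|ij] := eqVneq i j.
    by rewrite dot_normalizedE// monic_neq0.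
  rewrite dot_normalized.
  have [ltij|ltji|/val_inj eij] := ltngtP i j.
  + by rewrite P_orth// mulr0.
  + by rewrite dotC P_orth// rmorph0 mulr0.
  + by rewrite eij eqxx in ij.
- move=> i j; have [<-|ij] := eqVneq i j.
    by rewrite dot_normalizedE// nm.
  rewrite dot_normalized orth ?mulr0//.
  by rewrite /x_ nth_uniq ?ss.
Qed.

(** The kernel identity for [L := coefp m]: all polynomials of degree less
    than [m] drop out, and the monic ones of degree [m] contribute the inverse of
    their squared norm. *)
Lemma node_poly_leading (m : nat) (Q : {poly F}) (s : seq F) :
  Q \is monic -> size Q = m.+2 -> uniq s -> size s = m.+1 -> all (root Q) s ->
  (forall x y, x \in s -> y \in s -> x != y ->
    dot (node_poly Q x) (node_poly Q y) = 0) ->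
  \sum_(x <- s) (dot (node_poly Q x) (node_poly Q x))^-1 = (dot (P m) (P m))^-1.
Proof.
move=> Qm Qs us ss sQ orth.
have lcE q : q \is monic -> size q = m.+1 ->
    cj (normalized q)`_m * (normalized q)`_m = (dot q q)^-1.
  rewrite monicE lead_coefE => + sq; rewrite sq => /eqP q1.
  by rewrite coefZ q1 mulr1 fmorphV nrm_cj -invfM -expr2 nrm_sqr.
have := node_poly_kernel (coefp m) Qm Qs us ss sQ orth.
rewrite big_ord_recr/= [X in _ = X + _]big1 ?add0r => [|j _].
  rewrite lcE// => <-; rewrite big_seq [RHS]big_seq; apply: eq_bigr => x xs.
  by rewrite lcE ?size_node_poly ?Qs// node_poly_monic// (allP sQ).
by rewrite coefZ (nth_default _ (_ : size (P j) <= m)%N) ?mulr0 ?P_size.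
Qed.

End sesquilinear.

(** * Factorizations with simple zeros *)

Lemma uniq_of_no_double_factor (F : fieldType) (s : seq F) :
  (forall x r, \prod_(y <- s) ('X - y%:P) <> ('X - x%:P) * ('X - x%:P) * r) -> uniq s.
Proof.
elim: s => //= a s IH h; apply/andP; split.
  apply/negP => as_; apply: (h a (\prod_(y <- rem a s) ('X - y%:P))).
  by rewrite big_cons (big_rem a as_) /= mulrA.
apply: IH => x r sE; apply: (h x (('X - a%:P) * r)).
by rewrite big_cons sE mulrCA.
Qed.

Section splitting.
Context (R : rcfType).

(** A nonreal root [a + i b] produces the excluded factor with [b != 0], a
    double real root produces it with [b = 0]. *)
Lemma rcf_simple_split (p : {poly R}) : p \is monic ->
  (forall a b q, p <> (('X - a%:P) ^+ 2 + (b ^+ 2)%:P) * q) ->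
  exists2 s : seq R, uniq s & p = \prod_(x <- s) ('X - x%:P).
Proof.
have [k] := ubnP (size p); elim: k p => // k IH p; rewrite ltnS => pk pm pq.
have [p1|p1] := leqP (size p) 1.
  exists [::] => //; rewrite big_nil; have := size1_polyC p1 => pE.
  by move: pm; rewrite pE monicE lead_coefC => /eqP ->.
pose pC := map_poly (real_complex R) p.
have [z /rootP pz] : exists z, root pC z.
  by apply/closed_rootP; rewrite size_map_poly gtn_eqF.
case: z pz => a b pz.
have [b0|b0] := eqVneq b 0.
  have pa : root p a.
    move: pz; rewrite b0 -[(a +i* 0)%C]/(real_complex R a) horner_map /= => -[pa].
    exact/rootP.
  have pE : p = ('X - a%:P) * (p %/ ('X - a%:P)).
    by rewrite mulrC divpK// dvdp_XsubCl.
  set q := p %/ _ in pE.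
  have qm : q \is monic by rewrite -(monicMl _ (monicXsubC a)) -pE.
  have [|c d r qE|s us sE] := IH q _ qm.
  - by rewrite /q size_divp ?polyXsubC_eq0// size_XsubC subn1 prednK// ltnW.
  - by apply: (pq c d (('X - a%:P) * r)); rewrite mulrCA -qE.
  exists (a :: s); last by rewrite big_cons -sE.
  rewrite /= us andbT; apply/negP => as_.
  apply: (pq a 0 (\prod_(x <- rem a s) ('X - x%:P))).
  by rewrite expr0n /= addr0 expr2 -mulrA pE sE (big_rem a as_).
set d := ('X - a%:P) ^+ 2 + (b ^+ 2)%:P.
have sd : size d = 3%N.
  rewrite size_polyDl size_exp_XsubC// size_polyC.
  by case: (_ == _).
exfalso; apply: (pq a b (p %/ d)); rewrite -/d mulrC.
have : (size (p %% d)%R <= 2)%N by rewrite -ltnS -sd ltn_modp -size_poly_eq0 sd.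
move=> sr; rewrite {1}(divp_eq p d).
(* the remainder has degree at most one, real coefficients and the nonreal
   root [a + i b] *)
suff -> : p %% d = 0 by rewrite addr0.
have dz : (map_poly (real_complex R) d).[(a +i* b)%C] = 0.
  rewrite rmorphD rmorphXn rmorphB /= map_polyX !map_polyC /= !hornerE /=.
  by simpc; apply/eqP; rewrite eq_complex /=; apply/andP; split; apply/eqP; ring.
have rz : (map_poly (real_complex R) (p %% d)).[(a +i* b)%C] = 0.
  move: pz; rewrite /pC {1}(divp_eq p d) rmorphD rmorphM /= hornerD hornerM dz.
  by rewrite mulr0 add0r.
have rE : p %% d = ((p %% d)`_0)%:P + (p %% d)`_1 *: 'X.
  apply/polyP => -[|[|i]]; rewrite coefD coefC coefZ coefX /= ?mulr0 ?addr0//.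
    by rewrite mulr1 add0r.
  by rewrite nth_default// (leq_trans sr).
move: rz; rewrite rE.
rewrite rmorphD /= map_polyC map_polyZ map_polyX /= !hornerE /=.
move=> /eqP; simpc; rewrite eq_complex /= => /andP[/eqP h1 /eqP h2].
have r1 : (p %% d)`_1 = 0 by apply/eqP; move/eqP: h2; rewrite mulf_eq0 (negbTE b0) orbF.
move: h1; rewrite r1 mul0r addr0 => ->.
by rewrite scale0r addr0.
Qed.
End splitting.

Section self_reciprocal.
Context (C : numClosedFieldType).

Lemma paraorthogonal_monic (Phi : nat -> {poly C}) n b :
  Phi n \is monic -> size (Phi n) = n.+1 ->
  paraorthogonal Phi n b \is monic /\ size (paraorthogonal Phi n b) = n.+2.
Proof.
move=> Pm Ps.
have sX : size ('X * Phi n) = n.+2.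
  by rewrite mulrC size_mulX ?Ps// monic_neq0.
have sB : (size (- (b^* *: rev_poly n (Phi n))) < size ('X * Phi n)%R)%N.
  rewrite size_polyN sX ltnS; apply: leq_trans (size_scale_leq _ _) _.
  exact: size_poly.
split; last by rewrite /paraorthogonal size_polyDl.
rewrite monicE /paraorthogonal lead_coefDl// -monicE mulrC.
by rewrite monicMr// monicX.
Qed.

Lemma paraorthogonal_root0 (Phi : nat -> {poly C}) n b :
  Phi n \is monic -> size (Phi n) = n.+1 -> `|b| = 1 ->
  ~~ root (paraorthogonal Phi n b) 0.
Proof.
move=> Pm Ps b1; rewrite rootE /paraorthogonal !hornerE horner_coef0.
rewrite coef_poly /= subn0.
move: Pm; rewrite monicE lead_coefE Ps /= => /eqP ->.
rewrite rmorph1 mulr1 oppr_eq0 conjC_eq0 -normr_eq0 b1; exact: oner_neq0.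
Qed.

(** A paraorthogonal polynomial is self-reciprocal up to a constant, so that
    its zeros are symmetric with respect to the unit circle. *)
Lemma paraorthogonal_root_inv (Phi : nat -> {poly C}) n b z :
  size (Phi n) = n.+1 -> `|b| = 1 -> z != 0 ->
  root (paraorthogonal Phi n b) z -> root (paraorthogonal Phi n b) (z^*)^-1.
Proof.
move=> Ps b1 z0.
have zc0 : (z^*)^-1 != 0 by rewrite invr_eq0 conjC_eq0.
rewrite !rootE /paraorthogonal !hornerE.
rewrite !horner_rev_poly ?Ps// fmorphV /= conjCK invrK.
set p := (Phi n).[z]; set q := (Phi n).[_] => h.
have bb : b * b^* = 1 by rewrite -normCK b1 expr1n.
suff -> : (z^*)^-1 * q - b^* * ((z^*)^-1 ^+ n * p^*) =
    - b^* * (z^*)^-1 ^+ n.+1 * (z * p - b^* * (z ^+ n * q^*))^*.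
  by rewrite (eqP h) conjC0 mulr0.
rewrite rmorphB !rmorphM /= rmorphXn /= !conjCK exprS.
have zn : (z^*)^-1 ^+ n * z^* ^+ n = 1.
  by rewrite -exprMn mulVf ?expr1n// conjC_eq0.
have z1 : (z^*)^-1 * z^* = 1 by rewrite mulVf// conjC_eq0.
set u := (z^*)^-1 in zn z1 *; set y := z^* in zn z1 *.
transitivity (u * q * (b * b^*) * (u ^+ n * y ^+ n) - b^* * (u ^+ n * p^*) * (u * y)).
  by rewrite bb zn z1 !mulr1.
ring.
Qed.

End self_reciprocal.

(** * Orthogonal polynomials on the real line *)

Section real_line.
Context (R : realType) (mu : {finite_measure set (borelType R) -> \bar R}).
Context (M : R).
Hypothesis M_gt0 : 0 < M.
Hypothesis ae_bounded : {ae mu, forall x, `[- M, M]%classic x}.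
Hypothesis supp_infinite : infinite_set (msupport mu).

Let cptK : compact `[- M, M]%classic := @segment_compact R (- M) M.
Let integrable_cont (f : R -> R) (cf : continuous f) :=
  continuous_integrable cptK ae_bounded cf.
Let cont_horner (p : {poly R}) : continuous (horner p) := @continuous_horner R p.
Let cont_hornerM (p q : {poly R}) : continuous (fun x => p.[x] * q.[x]).
Proof. by move=> x; apply: cvgM; exact: cont_horner. Qed.

Lemma rdot_linear (p : {poly R}) a q r :
  rdot mu p (a *: q + r) = a * rdot mu p q + rdot mu p r.
Proof.
rewrite /rdot -RintegralZl//; last exact: integrable_cont.
rewrite -RintegralD//; last 2 first.
- apply: integrable_cont => x; apply: cvgM; first exact: cvg_cst.
  exact: cont_hornerM.
- exact: integrable_cont.
by apply: eq_Rintegral => x _ /=; rewrite hornerD hornerZ mulrDr mulrCA.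
Qed.

Lemma rdotC p q : rdot mu q p = idfun (rdot mu p q).
Proof. by apply: eq_Rintegral => x _; rewrite mulrC. Qed.

Lemma rdot_gt0 p : p != 0 -> 0 < rdot mu p p.
Proof.
move=> p0; have [x sx px] := infinite_set_nonroot supp_infinite p0.
apply: (Rintegral_gt0_support cptK ae_bounded _ _ sx) => //.
  by move=> y; rewrite -expr2 sqr_ge0.
by rewrite -expr2 lt_def sqrf_eq0 px sqr_ge0.
Qed.

Lemma rdot_ge0 p : 0 <= rdot mu p p.
Proof. by apply: Rintegral_ge0 => x _; rewrite -expr2 sqr_ge0. Qed.

Lemma rdot_mulA p q r : rdot mu (p * q) r = rdot mu p (q * r).
Proof. by apply: eq_Rintegral => x _; rewrite !hornerM mulrA. Qed.

Lemma rnorm_neq0 p : p != 0 -> rnorm mu p != 0.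
Proof. by move=> p0; rewrite gt_eqF// sqrtr_gt0 rdot_gt0. Qed.

Lemma rnorm_sqr p : rnorm mu p ^+ 2 = rdot mu p p.
Proof. by rewrite sqr_sqrtr// rdot_ge0. Qed.

Context (P : nat -> {poly R}).
Hypothesis P_OP : monic_OPRL mu P.

Let P_monic k : P k \is monic. Proof. by have [] := P_OP k. Qed.
Let P_size k : size (P k) = k.+1. Proof. by have [] := P_OP k. Qed.
Let P_orth m n : (m < n)%N -> rdot mu (P m) (P n) = 0.
Proof. by have [_ _] := P_OP n; apply. Qed.
Let P_lower m (q : {poly R}) : (size q <= m)%N -> rdot mu q (P m) = 0.
Proof. exact: (dot_orthogonal_lower rdot_linear rdotC P_monic P_size P_orth). Qed.

(** If [P k = ((X - a)^2 + b^2) q] then [<q, P k>] is the integral of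
    [((x - a)^2 + b^2) q^2], which is positive, while [q] has degree less than
    [k]. *)
Lemma OPRL_zeros k : exists2 s : seq R, uniq s & P k = \prod_(x <- s) ('X - x%:P).
Proof.
apply: rcf_simple_split => // a b q PE.
set d := ('X - a%:P) ^+ 2 + (b ^+ 2)%:P in PE.
have q0 : q != 0.
  by apply/eqP => q0; have := monic_neq0 (P_monic k); rewrite PE q0 mulr0 eqxx.
have sd : size d = 3%N.
  rewrite size_polyDl size_exp_XsubC// size_polyC.
  by case: (_ == _).
have sq : (size q <= k)%N.
  have := P_size k; rewrite PE size_mul// -?size_poly_eq0 ?sd// => /eqP.
  by rewrite !addSn add0n /= eqSS => /eqP <-.
have := P_lower sq; rewrite PE mulrDl.
rewrite (dotDr rdot_linear) mul_polyC (dotZr rdot_linear) expr2 -mulrA.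
rewrite -rdot_mulA [q * _]mulrC => /eqP; apply/negP; rewrite gt_eqF//.
rewrite ltr_pwDl//; last by rewrite mulr_ge0 ?sqr_ge0 ?rdot_ge0.
by rewrite rdot_gt0// mulf_neq0// polyXsubC_eq0.
Qed.

(** The linear factors can be moved across the real inner product: the product of
    the two node polynomials is [Q] times a polynomial of degree [k - 1]. *)
Lemma rdot_node_poly_orth (Q : {poly R}) k x y : Q = P k.+1 ->
  root Q x -> root Q y -> x != y ->
  rdot mu (node_poly Q x) (node_poly Q y) = 0.
Proof.
move=> QE Qx Qy xy.
have Qm : Q \is monic by rewrite QE.
have nx : root (node_poly Q x) y.
  move: Qy; rewrite {1}(node_polyK Qx) rootM root_XsubC eq_sym (negbTE xy).
  by [].
rewrite (node_polyK nx) mulrC rdot_mulA -node_polyK// QE P_lower//.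
by rewrite !size_node_poly P_size.
Qed.

(** [P k.+1] has minimal norm among the monic polynomials of degree [k.+1],
    one of which is [X * P k]. *)
Lemma rdot_OPRL_succ k :
  rdot mu (P k.+1) (P k.+1) <= M ^+ 2 * rdot mu (P k) (P k).
Proof.
pose r := 'X * P k - P k.+1.
have rs : (size r <= k.+1)%N.
  apply/leq_sizeP => j; rewrite leq_eqVlt /r coefB coefXM => /orP[/eqP <-|kj].
    have := P_monic k; have := P_monic k.+1.
    by rewrite !monicE !lead_coefE !P_size /= => /eqP-> /eqP->; rewrite subrr.
  have kj' : (k < j.-1)%N by rewrite -ltnS prednK// (leq_trans _ kj).
  by rewrite !nth_default ?P_size// if_same subr0.
have XE : 'X * P k = P k.+1 + r by rewrite addrC subrK.
clearbody r.
have -> : rdot mu (P k.+1) (P k.+1) = rdot mu ('X * P k) ('X * P k) - rdot mu r r.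
  rewrite XE (dotDr rdot_linear) !(dotDl rdot_linear rdotC).
  rewrite (P_lower rs) [rdot mu (P k.+1) r]rdotC /= (P_lower rs).
  by rewrite addr0 add0r addrK.
apply: (@le_trans _ _ (rdot mu ('X * P k) ('X * P k))).
  by rewrite gerDl oppr_le0 rdot_ge0.
rewrite {2}/rdot -RintegralZl//; last exact: integrable_cont.
apply: (ae_le_Rintegral cptK ae_bounded) => //.
  by move=> x; apply: cvgM; [exact: cvg_cst | exact: cont_hornerM].
move=> x /=; rewrite in_itv /= -ler_norml => xM.
rewrite !hornerM hornerX mulrACA ler_wpM2r//; first by rewrite -expr2 sqr_ge0.
by rewrite -expr2 -real_normK ?num_real// lerXn2r// nnegrE ltW.
Qed.

Lemma weak_cvg_OPRL (n : nat -> nat) (l : set (borelType R) -> \bar R) :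
  {homo n : i j / (i < j)%N} ->
  weak_cvg (fun j => zero_counting R (P (n j).+1)) l <->
  weak_cvg (fun j => density mu
    (fun x => (n j).+1%:R^-1 * rCD mu P (n j) x x)) l.
Proof.
move=> n_incr.
have [s sP] : {s : nat -> seq R & forall k,
    uniq (s k) /\ P k.+1 = \prod_(x <- s k) ('X - x%:P)}.
  apply: (@choice _ _ (fun k (s : seq R) =>
    uniq s /\ P k.+1 = \prod_(x <- s) ('X - x%:P))) => k.
  by have [s] := OPRL_zeros k.+1; exists s.
have su k : uniq (s k) by have [] := sP k.
have sE k : P k.+1 = \prod_(x <- s k) ('X - x%:P) by have [] := sP k.
have ss k : size (s k) = k.+1.
  by have := P_size k.+1; rewrite sE size_prod_XsubC => -[].
have sroot k : all (root (P k.+1)) (s k).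
  by apply/allP => x xs; rewrite sE root_prod_XsubC.
have orth k x y : x \in s k -> y \in s k -> x != y ->
    rdot mu (node_poly (P k.+1) x) (node_poly (P k.+1) y) = 0.
  move=> xs ys; apply: rdot_node_poly_orth => //; exact: (allP (sroot k)).
have node0 k x : x \in s k -> node_poly (P k.+1) x != 0.
  by move=> xs; apply/monic_neq0/node_poly_monic => //; exact: (allP (sroot k)).
pose e k x := normalized (rnorm mu) (node_poly (P k.+1) x).
pose w k (x y : R) := (e k x).[y] ^+ 2.
have -> : (fun j => zero_counting R (P (n j).+1)) =
    (fun j => normalized_counting R (s (n j))).
  by apply/funext => j; apply/funext => A; rewrite sE zero_counting_simple.
have -> : (fun j => density mu (fun x => (n j).+1%:R^-1 * rCD mu P (n j) x x)) =
    (fun j => density mu (fun y => (n j).+1%:R^-1 * \sum_(x <- s (n j)) w (n j) x y)).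
  apply/funext => j; congr density; apply/funext => y; congr (_ * _).
  have := node_poly_kernel rdot_linear rdotC rnorm_neq0 (fun=> erefl) rnorm_sqr
    P_monic P_size P_orth (horner_eval y) (P_monic (n j).+1) (P_size _)
    (su _) (ss _) (sroot _) (orth _).
  by move=> /= /esym kE; rewrite /rCD [LHS]kE; apply: eq_bigr => x _; rewrite /w expr2.
have cw k x : continuous (w k x).
  by rewrite /w; under eq_fun do rewrite expr2; exact: cont_hornerM.
apply: (weak_cvg_counting_density cptK ae_bounded (D := fun x y => `|x - y|) _ _
  (B := M ^+ 2)) => //.
- by move=> x y; apply: cvg_norm; apply: cvgB; [exact: cvg_cst|exact: cvg_id].
- move=> f cf eps eps0.
  apply: (compact_uniform_continuity (D := fun x y => `|x - y|)) => //.
  + by move=> x y z; exact: ler_distD.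
  + move=> y U /nbhs_ballP[d /= d0 dU]; exists d => // x xy; apply: dU.
    by rewrite /ball /= distrC.
  + move=> y d d0; near=> z; rewrite distrC; near: z.
    exact: (@cvgr_dist_lt _ _ _ _ _ (@id R) y cvg_id).
  + by move=> x y; rewrite distrC.
- by move=> k x y; rewrite sqr_ge0.
- move=> k x xs; rewrite /w.
  under eq_Rintegral do rewrite expr2.
  apply: (dot_normalizedE rdot_linear rdotC rnorm_neq0 (fun=> erefl) rnorm_sqr).
  exact: node0.
- move=> k.
  have dE x : x \in s k -> \int[mu]_(y in [set: borelType R]) (`|x - y| ^+ 2 * w k x y) =
      rdot mu (P k.+1) (P k.+1) *
      (rdot mu (node_poly (P k.+1) x) (node_poly (P k.+1) x))^-1.
    move=> xs; rewrite mulrC -[rdot mu (node_poly _ _) _]rnorm_sqr /rdot.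
    rewrite -RintegralZl//; last exact: integrable_cont.
    apply: eq_Rintegral => y _.
    rewrite real_normK ?num_real// /w /e /normalized hornerZ exprMn mulrCA exprVn.
    congr (_ * _); rewrite -expr2 {2}(node_polyK (allP (sroot k) x xs)) hornerM.
    by rewrite hornerXsubC exprMn -[y - x]opprB sqrrN.
  rewrite big_seq; under eq_bigr => x xs do rewrite dE//.
  rewrite -mulr_sumr -big_seq.
  rewrite (node_poly_leading rdot_linear rdotC rnorm_neq0 (fun=> erefl) rnorm_sqr
    P_monic P_size P_orth (P_monic k.+1) (P_size _) (su _) (ss _) (sroot _) (orth _)).
  rewrite ler_pdivrMr; last by rewrite rdot_gt0// monic_neq0.
  exact: rdot_OPRL_succ.
Unshelve. all: by end_near. Qed.

End real_line.

(** * The modulus and the topology of the complex plane *)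

Import ComplexField.Normc.

Section complex_modulus.
Context (R : realType).
Implicit Types z w : R[i].

Lemma normc_ge0 z : 0 <= normc z.
Proof. by case: z => a b; exact: sqrtr_ge0. Qed.

Lemma normrcE z : `|z| = (normc z)%:C%C.
Proof. by case: z. Qed.

Lemma normc_distC z w : normc (z - w) = normc (w - z).
Proof. by rewrite -normcN opprB. Qed.

Lemma normc_conj z : normc z^* = normc z.
Proof. by apply: (@complexI R); rewrite -!normrcE norm_conjC. Qed.

Lemma sqr_normcE z : normc z ^+ 2 = complex.Re z ^+ 2 + complex.Im z ^+ 2.
Proof. by case: z => a b; rewrite sqr_sqrtr// addr_ge0 ?sqr_ge0. Qed.

Lemma mulcJE z : z^* * z = (normc z ^+ 2)%:C%C.
Proof. by rewrite mulrC -normCK normrcE rmorphXn. Qed.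

Lemma normc_Re z : `|complex.Re z| <= normc z.
Proof. by rewrite -lecR -normrcE; exact: normc_ge_Re. Qed.

Lemma normc_Im z : `|complex.Im z| <= normc z.
Proof.
rewrite -ler_sqr ?nnegrE ?normr_ge0 ?normc_ge0// real_normK ?num_real//.
by rewrite sqr_normcE lerDr sqr_ge0.
Qed.

Lemma normc_le_ReIm z : normc z <= `|complex.Re z| + `|complex.Im z|.
Proof.
rewrite -ler_sqr ?nnegrE ?addr_ge0 ?normr_ge0 ?normc_ge0//.
rewrite sqr_normcE sqrrD !real_normK ?num_real//.
by rewrite [leRHS]addrAC lerDl mulrn_wge0// mulr_ge0.
Qed.

(** Positive elements of [R[i]] are positive reals, so real radii suffice. *)
Lemma nbhs_cplxP (z : cplx R) (U : set (cplx R)) :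
  nbhs z U <-> exists2 d : R, 0 < d & forall w, normc (z - w) < d -> U w.
Proof.
split=> [/nbhs_ballP[e /= e0 eU]|[d d0 dU]].
  have [eR e0'] : e = (complex.Re e)%:C%C /\ 0 < complex.Re e.
    move: e0; rewrite ltcE /= => /andP[/eqP ei ->]; split => //.
    by move: ei; case: (e) => ? ? /= ->.
  exists (complex.Re e) => // w zw; apply: eU.
  by rewrite -ball_normE /= normrcE eR ltcR.
apply/nbhs_ballP; exists d%:C%C; first by rewrite /= ltcR.
by move=> w; rewrite -ball_normE /= normrcE ltcR => /dU.
Qed.

Lemma near_cplx (z : cplx R) (d : R) : 0 < d -> \forall w \near z, normc (z - w) < d.
Proof. by move=> d0; apply/nbhs_cplxP; exists d. Qed.

Lemma lipschitz_cplx_continuous (f : cplx R -> R) :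
  (forall z w, `|f z - f w| <= normc (z - w)) -> continuous f.
Proof.
move=> fL z; apply/(@cvgrPdist_lt _ _ _ (nbhs z) (nbhs_filter z)) => e e0.
apply: (@filterS _ (nbhs z) (nbhs_filter z) _ _ _ (near_cplx z e0)) => w.
exact: le_lt_trans.
Qed.

Lemma continuous_Re : continuous (@complex.Re R : cplx R -> R).
Proof.
apply: lipschitz_cplx_continuous => z w.
by apply: le_trans (normc_Re _); case: z w => [a b] [c d].
Qed.

Lemma continuous_Im : continuous (@complex.Im R : cplx R -> R).
Proof.
apply: lipschitz_cplx_continuous => z w.
by apply: le_trans (normc_Im _); case: z w => [a b] [c d].
Qed.

Lemma normc_distD x y z : normc (x - z) <= normc (x - y) + normc (y - z) :> R.
Proof. by rewrite (le_trans _ (le_normcD _ _))// addrA subrK. Qed.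

Lemma continuous_normc_dist (x : R[i]) :
  continuous (fun y : cplx R => normc (x - y)).
Proof.
apply: lipschitz_cplx_continuous => z w; rewrite ler_norml; apply/andP; split.
  by rewrite lerBrDl lerBlDr; exact: normc_distD.
by rewrite lerBlDl [normc (z - w)]normc_distC; exact: normc_distD.
Qed.

Lemma closed_unit_circle : closed (unit_circle R).
Proof.
have -> : unit_circle R = (fun z : cplx R => normc (0 - z)) @^-1` [set 1].
  apply/seteqP; split => z; rewrite /unit_circle /= sub0r normcN normrcE.
    by move/(@complexI R).
  by move=> ->.
apply: closed_comp; first by move=> z _; exact: continuous_normc_dist.
exact: closed_eq.
Qed.

(** A closed subset of the image of a square in the plane. *)
Lemma compact_unit_circle : compact (unit_circle R).
Proof.
pose g (p : R * R) : cplx R := (p.1 +i* p.2)%C.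
have cg : continuous g.
  move=> p; apply/cvg_ballP => e e0.
  have [d [d0 dE]] : exists d : R, 0 < d /\ e = d%:C%C.
    move: e0; rewrite ltcE /= => /andP[/eqP ei e0]; exists (complex.Re e).
    by split => //; move: ei; case: (e) => ? ? /= ->.
  have d2 : 0 < d / 2 by rewrite divr_gt0.
  near=> q; rewrite -ball_normE /= normrcE dE ltcR.
  apply: le_lt_trans (normc_le_ReIm _) _; rewrite /= [ltRHS]splitr ltrD//.
    near: q; apply: (@cvgr_dist_lt _ _ _ _ _ fst p.1) => //; exact: cvg_fst.
  near: q; apply: (@cvgr_dist_lt _ _ _ _ _ snd p.2) => //; exact: cvg_snd.
pose S : set (R * R) := `[- 1, 1]%classic `*` `[- 1, 1]%classic.
have cS : compact (g @` S).
  apply: continuous_compact; first exact: continuous_subspaceT.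
  by apply: compact_setX; exact: segment_compact.
apply: (subclosed_compact closed_unit_circle cS).
move=> z /= z1; have n1 : normc z = 1 by apply: (@complexI R); rewrite -normrcE.
exists (complex.Re z, complex.Im z); last by case: (z).
by split; rewrite /= in_itv /= -ler_norml -n1 ?normc_Re ?normc_Im.
Unshelve. all: by end_near. Qed.

Lemma normc_unit z : unit_circle R z -> normc z = 1.
Proof. by move=> z1; apply: (@complexI R); rewrite -normrcE. Qed.

Lemma conj_unit z : unit_circle R z -> z * z^* = 1.
Proof. by move=> z1; rewrite -normCK (z1 : `|z| = 1) expr1n. Qed.

(** Complex integrals are taken componentwise, and so is continuity. *)
Definition cplx_continuous (f : R[i] -> R[i]) : Prop :=
  continuous (fun z : cplx R => complex.Re (f z)) /\
  continuous (fun z : cplx R => complex.Im (f z)).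

Lemma cplx_continuous_cst (a : R[i]) : cplx_continuous (fun=> a).
Proof. by split; exact: cst_continuous. Qed.

Lemma cplx_continuous_id : cplx_continuous id.
Proof. by split; [exact: continuous_Re|exact: continuous_Im]. Qed.

Lemma cReD z w : complex.Re (z + w) = complex.Re z + complex.Re w.
Proof. by case: z w => [a b] [c d]. Qed.

Lemma cImD z w : complex.Im (z + w) = complex.Im z + complex.Im w.
Proof. by case: z w => [a b] [c d]. Qed.

Lemma cReM z w : complex.Re (z * w) =
  complex.Re z * complex.Re w - complex.Im z * complex.Im w.
Proof. by case: z w => [a b] [c d]. Qed.

Lemma cImM z w : complex.Im (z * w) =
  complex.Re z * complex.Im w + complex.Im z * complex.Re w.
Proof. by case: z w => [a b] [c d]. Qed.

Lemma cReJ z : complex.Re z^* = complex.Re z.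
Proof. by case: z. Qed.

Lemma cImJ z : complex.Im z^* = - complex.Im z.
Proof. by case: z. Qed.

Lemma cplx_continuousD f g : cplx_continuous f -> cplx_continuous g ->
  cplx_continuous (fun z => f z + g z).
Proof.
move=> [f1 f2] [g1 g2]; split.
  by under eq_fun do rewrite cReD; move=> z; exact: (cvgD (f1 z) (g1 z)).
by under eq_fun do rewrite cImD; move=> z; exact: (cvgD (f2 z) (g2 z)).
Qed.

Lemma cplx_continuousM f g : cplx_continuous f -> cplx_continuous g ->
  cplx_continuous (fun z => f z * g z).
Proof.
move=> [f1 f2] [g1 g2]; split.
  under eq_fun do rewrite cReM; move=> z.
  exact: (cvgB (cvgM (f1 z) (g1 z)) (cvgM (f2 z) (g2 z))).
under eq_fun do rewrite cImM; move=> z.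
exact: (cvgD (cvgM (f1 z) (g2 z)) (cvgM (f2 z) (g1 z))).
Qed.

Lemma cplx_continuousJ f : cplx_continuous f -> cplx_continuous (fun z => (f z)^*).
Proof.
move=> [f1 f2]; split; first by under eq_fun do rewrite cReJ.
by under eq_fun do rewrite cImJ; move=> z; exact: (cvgN (f2 z)).
Qed.

Lemma cplx_continuous_horner (p : {poly R[i]}) : cplx_continuous (horner p).
Proof.
elim/poly_ind : p => [|p c IH].
  rewrite (_ : horner 0 = fun=> 0); first exact: cplx_continuous_cst.
  by apply/funext => z; rewrite horner0.
rewrite (_ : horner _ = fun z => p.[z] * z + c).
  apply: cplx_continuousD; last exact: cplx_continuous_cst.
  by apply: cplx_continuousM => //; exact: cplx_continuous_id.
by apply/funext => z; rewrite hornerMXaddC.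
Qed.

Lemma continuous_sqr_normc f : cplx_continuous f ->
  continuous (fun z : cplx R => normc (f z) ^+ 2).
Proof.
move=> [f1 f2]; under eq_fun do rewrite sqr_normcE !expr2.
by move=> z; exact: (cvgD (cvgM (f1 z) (f1 z)) (cvgM (f2 z) (f2 z))).
Qed.

End complex_modulus.

(** * Orthogonal polynomials on the unit circle *)

Section unit_circle.
Context (R : realType) (mu : {finite_measure set (borelType (cplx R)) -> \bar R}).
Hypothesis mu_circle : mu (~` unit_circle R) = 0%E.
Hypothesis supp_infinite : infinite_set (msupport mu).

Lemma ae_unit_circle : {ae mu, forall z, unit_circle R z}.
Proof.
exists (~` unit_circle R); split => //.
by apply: open_borel_measurable; apply: closed_openC; exact: closed_unit_circle.
Qed.

Let cptK := @compact_unit_circle R.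
Let aeK := ae_unit_circle.
Let integrable_cont (f : cplx R -> R) (cf : continuous f) :=
  continuous_integrable cptK aeK cf.

Lemma cintegralD f g : cplx_continuous f -> cplx_continuous g ->
  cintegral mu (fun z => f z + g z) = cintegral mu f + cintegral mu g.
Proof.
move=> [f1 f2] [g1 g2]; apply/eqP; rewrite eq_complex /=.
rewrite -!RintegralD//; try exact: integrable_cont.
by apply/andP; split; apply/eqP; apply: eq_Rintegral => z _; rewrite ?cReD ?cImD.
Qed.

Lemma cintegralZ a f : cplx_continuous f ->
  cintegral mu (fun z => a * f z) = a * cintegral mu f.
Proof.
move=> [f1 f2]; apply/eqP; rewrite eq_complex cReM cImM /=.
have cZ (b : R) (h : cplx R -> R) : continuous h -> continuous (fun z => b * h z).
  by move=> ch z; have cb := @cst_continuous (cplx R) R b z; exact: (cvgM cb (ch z)).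
rewrite -!RintegralZl//; try exact: integrable_cont.
rewrite -RintegralB//; try by apply: integrable_cont; exact: cZ.
rewrite -RintegralD//; try by apply: integrable_cont; exact: cZ.
by apply/andP; split; apply/eqP; apply: eq_Rintegral => z _; rewrite ?cReM ?cImM.
Qed.

Lemma cintegralJ f : cplx_continuous f ->
  cintegral mu (fun z => (f z)^*) = (cintegral mu f)^*.
Proof.
move=> [f1 f2]; apply/eqP; rewrite eq_complex /=.
have E : - (\int[mu]_(z in [set: borelType (cplx R)]) complex.Im (f z)) =
    \int[mu]_(z in [set: borelType (cplx R)]) (-1 * complex.Im (f z)).
  by rewrite RintegralZl ?mulN1r//; exact: integrable_cont.
rewrite E; apply/andP; split; apply/eqP; apply: eq_Rintegral => z _.
  by rewrite cReJ.
by rewrite cImJ mulN1r.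
Qed.

Lemma eq_cintegral f g : cplx_continuous f -> cplx_continuous g ->
  (forall z, unit_circle R z -> f z = g z) -> cintegral mu f = cintegral mu g.
Proof.
move=> [f1 f2] [g1 g2] fg; apply/eqP; rewrite eq_complex /=.
by apply/andP; split; apply/eqP; apply: (ae_eq_Rintegral cptK aeK) => // z /fg ->.
Qed.

Let cont_cdot (p q : {poly R[i]}) : cplx_continuous (fun z => (p.[z])^* * q.[z]).
Proof.
apply: cplx_continuousM; last exact: cplx_continuous_horner.
by apply: cplx_continuousJ; exact: cplx_continuous_horner.
Qed.

Lemma cdot_linear (p : {poly R[i]}) a q r :
  cdot mu p (a *: q + r) = a * cdot mu p q + cdot mu p r.
Proof.
rewrite /cdot -cintegralZ// -cintegralD//; last first.
  by apply: cplx_continuousM => //; exact: cplx_continuous_cst.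
congr cintegral; apply/funext => z.
by rewrite hornerD hornerZ mulrDr mulrCA.
Qed.

Lemma cdotC (p q : {poly R[i]}) : cdot mu q p = Num.conj (cdot mu p q).
Proof.
rewrite /cdot -cintegralJ//; congr cintegral; apply/funext => z.
by rewrite rmorphM /= conjCK mulrC.
Qed.

(** Inner products only depend on the values on the circle, where
    [conj z = 1 / z]; all the orthogonality relations below come from pointwise
    identities of this kind. *)
Lemma eq_cdot (a : R[i]) (p q p' q' : {poly R[i]}) :
  (forall z, unit_circle R z -> (p.[z])^* * q.[z] = a * ((p'.[z])^* * q'.[z])) ->
  cdot mu p q = a * cdot mu p' q'.
Proof.
move=> h; rewrite /cdot -cintegralZ//; apply: eq_cintegral => //.
by apply: cplx_continuousM => //; exact: cplx_continuous_cst.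
Qed.

Definition csqnorm (p : {poly R[i]}) : R :=
  \int[mu]_(z in [set: borelType (cplx R)]) (normc p.[z] ^+ 2).

Let cont_sqnorm (p : {poly R[i]}) :
  continuous (fun z : cplx R => normc p.[z] ^+ 2).
Proof. by apply: continuous_sqr_normc; exact: cplx_continuous_horner. Qed.

Lemma cdot_sqnorm p : cdot mu p p = (csqnorm p)%:C%C.
Proof.
apply/eqP; rewrite eq_complex /=; apply/andP; split; apply/eqP.
  by apply: eq_Rintegral => z _; rewrite mulcJE.
under eq_Rintegral do rewrite mulcJE /=.
by rewrite Rintegral_cst// mul0r.
Qed.

Lemma csqnorm_ge0 p : 0 <= csqnorm p.
Proof. by apply: Rintegral_ge0 => z _; exact: sqr_ge0. Qed.

Lemma csqnorm_gt0 p : p != 0 -> 0 < csqnorm p.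
Proof.
move=> p0; have [x sx px] := infinite_set_nonroot supp_infinite p0.
apply: (Rintegral_gt0_support cptK aeK _ _ sx) => //.
  by move=> y; exact: sqr_ge0.
rewrite lt_def sqr_ge0 andbT sqrf_eq0; apply: contra px => /eqP n0.
by apply/eqP/(@eq0_normc R).
Qed.

Lemma cnorm_sqr p : (cnorm mu p)%:C%C ^+ 2 = cdot mu p p.
Proof. by rewrite -rmorphXn /= sqr_sqrtr cdot_sqnorm //= csqnorm_ge0. Qed.

Lemma cnorm_neq0 p : p != 0 -> (cnorm mu p)%:C%C != 0.
Proof.
move=> p0; rewrite (inj_eq (@complexI R)) gt_eqF// sqrtr_gt0 cdot_sqnorm /=.
exact: csqnorm_gt0.
Qed.

Lemma cnorm_conj p : Num.conj (cnorm mu p)%:C%C = (cnorm mu p)%:C%C.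
Proof. exact: conjc_real. Qed.

Context (Phi : nat -> {poly R[i]}).
Hypothesis Phi_OP : monic_OPUC mu Phi.

Let Phi_monic k : Phi k \is monic. Proof. by have [] := Phi_OP k. Qed.
Let Phi_size k : size (Phi k) = k.+1. Proof. by have [] := Phi_OP k. Qed.
Let Phi_orth m n : (m < n)%N -> cdot mu (Phi m) (Phi n) = 0.
Proof. by have [_ _] := Phi_OP n; apply. Qed.
Let Phi_lower m (q : {poly R[i]}) : (size q <= m)%N -> cdot mu q (Phi m) = 0.
Proof. exact: (dot_orthogonal_lower cdot_linear cdotC Phi_monic Phi_size Phi_orth). Qed.

Lemma horner_rev_poly_circle k (p : {poly R[i]}) z : (size p <= k.+1)%N ->
  unit_circle R z -> (rev_poly k p).[z] = z ^+ k * (p.[z])^*.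
Proof.
move=> sp z1; have z0 : z != 0.
  by rewrite -normr_eq0 (z1 : `|z| = 1) oner_neq0.
rewrite horner_rev_poly//; congr (_ * (p.[_])^*).
have zc0 : z^* != 0 by rewrite conjC_eq0.
by apply: (mulIf zc0); rewrite mulVf// conj_unit.
Qed.

(** Multiplication by [z] is isometric on the circle, which handles
    [X * Phi k].  For the reversed polynomial,
    [conj (z r) z^k conj Phi = conj Phi * r^*] on the circle, where
    [r^*(z) = z^(k - 1) conj r(z)] is a polynomial of degree less than [k]. *)
Lemma paraorthogonal_orth k b (r : {poly R[i]}) : (size r <= k)%N ->
  cdot mu ('X * r) (paraorthogonal Phi k b) = 0.
Proof.
move=> rk; rewrite (dotBr cdot_linear) (dotZr cdot_linear).
have -> : cdot mu ('X * r) ('X * Phi k) = 0.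
  rewrite (@eq_cdot 1 _ _ r (Phi k)) ?mul1r ?Phi_lower// => z z1.
  by rewrite !hornerM hornerX rmorphM /= mul1r mulrACA [_^* * z]mulrC conj_unit// mul1r.
suff -> : cdot mu ('X * r) (rev_poly k (Phi k)) = 0 by rewrite mulr0 subr0.
(* [rev_poly k r] below is for degree [k], where [r] has size at most [k.+1] *)
case: k rk => [|k] rk.
  move: rk; rewrite size_poly_leq0 => /eqP ->.
  by rewrite mulr0 (dot0l cdot_linear cdotC).
rewrite (@eq_cdot 1 _ _ (Phi k.+1) (rev_poly k r)) => [|z z1].
  by rewrite cdotC Phi_lower ?size_poly// conjC0 mulr0.
rewrite !horner_rev_poly_circle ?Phi_size// hornerM hornerX rmorphM /= mul1r.
rewrite exprS -{2}[z ^+ k]mul1r -(conj_unit z1); ring.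
Qed.

(** On the circle [conj z (z - 1/conj z0)] is [- (1/conj z0) conj (z - z0)].
    Hence the inner product of [X * r] with the paraorthogonal polynomial would
    be a nonzero multiple of the squared norm of [(X - z0) r]. *)
Lemma paraorthogonal_no_symmetric_factor k b z0 (r : {poly R[i]}) : `|b| = 1 ->
  paraorthogonal Phi k b <> ('X - z0%:P) * ('X - ((z0^*)^-1)%:P) * r.
Proof.
move=> b1 QE.
have [Qm Qs] := paraorthogonal_monic b (Phi_monic k) (Phi_size k).
have r0 : r != 0.
  by apply/eqP => r0; have := monic_neq0 Qm; rewrite QE r0 mulr0 eqxx.
have z00 : z0 != 0.
  apply: contraNneq (paraorthogonal_root0 (Phi_monic k) (Phi_size k) b1) => z00.
  by rewrite QE !rootM root_XsubC z00 eqxx.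
have sr : (size r <= k)%N.
  move: Qs; rewrite QE -mulrA.
  rewrite size_monicM ?monicXsubC// ?mulf_neq0// ?polyXsubC_eq0// size_XsubC.
  by rewrite size_monicM ?monicXsubC// size_XsubC => -[<-].
have := paraorthogonal_orth b sr; rewrite QE.
rewrite (@eq_cdot (- (z0^*)^-1) _ _ (('X - z0%:P) * r) (('X - z0%:P) * r)).
  rewrite cdot_sqnorm => /eqP; apply/negP; rewrite mulf_neq0//.
    by rewrite oppr_eq0 invr_eq0 conjC_eq0.
  rewrite (inj_eq (@complexI R)) gt_eqF// csqnorm_gt0//.
  by rewrite mulf_neq0// polyXsubC_eq0.
move=> z z1; rewrite !hornerM hornerX !hornerXsubC !rmorphM /= rmorphB /=.
have zz := conj_unit z1.
have zc0 : z0^* != 0 by rewrite conjC_eq0.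
have -> : z - (z0^*)^-1 = - (z0^*)^-1 * (z * (z^* - z0^*)).
  by rewrite mulrBr zz mulrBr mulNr mulr1 mulNr mulrCA mulVf// mulr1 opprK addrC.
transitivity (- (z0^*)^-1 * ((z^* - z0^*) * (r.[z])^* * ((z - z0) * r.[z])) * (z * z^*)).
  by ring.
by rewrite zz mulr1.
Qed.

(** A zero off the circle comes with its mirror image, and a double zero on
    the circle is its own mirror image; both produce the symmetric factor. *)
Lemma paraorthogonal_zeros k b : `|b| = 1 -> exists s : seq R[i],
  [/\ uniq s, {in s, forall z, `|z| = 1} &
      paraorthogonal Phi k b = \prod_(z <- s) ('X - z%:P)].
Proof.
move=> b1.
have [Qm Qs] := paraorthogonal_monic b (Phi_monic k) (Phi_size k).
set Q := paraorthogonal Phi k b in Qm Qs *.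
have [s sE] := closed_field_poly_normal Q.
have QE : Q = \prod_(z <- s) ('X - z%:P) by rewrite sE (monicP Qm) scale1r.
have rs z : root Q z = (z \in s) by rewrite QE root_prod_XsubC.
have s1 z : z \in s -> `|z| = 1.
  move=> zs; have z0 : z != 0.
    apply: contraTneq zs => ->.
    by rewrite -rs (paraorthogonal_root0 (Phi_monic k) (Phi_size k) b1).
  have [zz|zz] := eqVneq (z^*)^-1 z.
    have : `|z| ^+ 2 = 1 by rewrite normCK -{1}zz mulVf// conjC_eq0.
    by move/eqP; rewrite sqrp_eq1// => /eqP.
  have zs' : (z^*)^-1 \in rem z s.
    have := perm_mem (perm_to_rem zs) (z^*)^-1.
    rewrite inE (negbTE zz) /= => <-.
    by rewrite -rs; apply: (paraorthogonal_root_inv (Phi_size k) b1 z0); rewrite -/Q rs.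
  exfalso; apply: (@paraorthogonal_no_symmetric_factor k b z
    (\prod_(y <- rem (z^*)^-1 (rem z s)) ('X - y%:P)) b1).
  by rewrite -/Q QE (big_rem z zs) /= (big_rem _ zs') /= mulrA.
exists s; split => //.
apply: uniq_of_no_double_factor => x r sxE.
have xs : x \in s by rewrite -rs QE sxE !rootM root_XsubC eqxx.
apply: (@paraorthogonal_no_symmetric_factor k b x r b1).
rewrite -/Q QE sxE; congr (_ * ('X - _%:P) * _).
have x0 : x^* != 0 by rewrite conjC_eq0 -normr_eq0 s1 ?oner_neq0.
by apply: (mulIf x0); rewrite mulVf// -normCK s1 ?expr1n.
Qed.

(** On the circle [conj (z - y) = - conj y * conj z * (z - y)], which moves
    the factor [z - y] from one node polynomial to the other and leaves
    [X * r] against [Q]. *)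
Lemma cdot_node_poly_orth k b x y : `|b| = 1 ->
  let Q := paraorthogonal Phi k b in
  root Q x -> root Q y -> `|y| = 1 -> x != y ->
  cdot mu (node_poly Q x) (node_poly Q y) = 0.
Proof.
move=> b1 Q Qx Qy y1 xy.
have [Qm Qs] := paraorthogonal_monic b (Phi_monic k) (Phi_size k).
have nx : root (node_poly Q x) y.
  move: Qy; rewrite {1}(node_polyK Qx) rootM root_XsubC eq_sym (negbTE xy).
  by [].
set r := node_poly (node_poly Q x) y.
have rE : node_poly Q x = ('X - y%:P) * r by exact: node_polyK.
have sr : (size r <= k)%N by rewrite !size_node_poly Qs.
rewrite (@eq_cdot (- y^*) _ _ ('X * r) Q) => [|z z1].
  by rewrite paraorthogonal_orth// mulr0.
rewrite rE {2}(node_polyK Qy) !hornerM hornerX !hornerXsubC !rmorphM /= rmorphB /=.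
have -> : z^* - y^* = - y^* * z^* * (z - y).
  have -> : - y^* * z^* * (z - y) = (y * y^*) * z^* - y^* * (z * z^*) by ring.
  by rewrite (conj_unit z1) -normCK y1 expr1n mul1r mulr1.
ring.
Qed.

(** Both terms of the paraorthogonal polynomial have the modulus of [Phi k]
    on the circle. *)
Lemma csqnorm_paraorthogonal k b : `|b| = 1 ->
  csqnorm (paraorthogonal Phi k b) <= 4 * csqnorm (Phi k).
Proof.
move=> b1; rewrite /csqnorm -RintegralZl//; last exact: integrable_cont.
apply: (ae_le_Rintegral cptK aeK) => // [z|z z1].
  have c4 := @cst_continuous (cplx R) R 4 z.
  have cq := @cont_sqnorm (Phi k) z.
  exact: (cvgM c4 cq).
have nb : normc b = 1 by apply: (@complexI R); rewrite -normrcE.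
have -> : 4 * normc (Phi k).[z] ^+ 2 = (normc (Phi k).[z] + normc (Phi k).[z]) ^+ 2.
  by ring.
rewrite ler_sqr ?nnegrE ?addr_ge0 ?normc_ge0//.
rewrite /paraorthogonal hornerD hornerN hornerM hornerX hornerZ.
apply: le_trans (le_normcD _ _) _; rewrite normcN !normcM normc_unit// mul1r.
rewrite normc_conj nb mul1r horner_rev_poly_circle ?Phi_size// normcM normc_conj.
suff -> : normc (z ^+ k) = 1 by rewrite mul1r.
by apply: (@complexI R); rewrite -normrcE normrX (z1 : `|z| = 1) expr1n.
Qed.

Lemma weak_cvg_OPUC (n : nat -> nat) (beta : nat -> R[i])
    (l : set (borelType (cplx R)) -> \bar R) :
  {homo n : i j / (i < j)%N} -> (forall k, `|beta k| = 1) ->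
  weak_cvg (T := cplx R)
    (fun j => zero_counting R (paraorthogonal Phi (n j) (beta (n j).+1))) l <->
  weak_cvg (T := cplx R) (fun j => density mu
    (fun z => (n j).+1%:R^-1 * complex.Re (cCD mu Phi (n j) z z))) l.
Proof.
move=> n_incr beta1.
pose Q k := paraorthogonal Phi k (beta k.+1).
have Qm k : Q k \is monic.
  by have [] := paraorthogonal_monic (beta k.+1) (Phi_monic k) (Phi_size k).
have Qs k : size (Q k) = k.+2.
  by have [] := paraorthogonal_monic (beta k.+1) (Phi_monic k) (Phi_size k).
have [s sP] : {s : nat -> seq R[i] & forall k,
    [/\ uniq (s k), {in s k, forall z, `|z| = 1} &
      Q k = \prod_(z <- s k) ('X - z%:P)]}.
  apply: (@choice _ _ (fun k (s : seq R[i]) =>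
    [/\ uniq s, {in s, forall z, `|z| = 1} &
      Q k = \prod_(z <- s) ('X - z%:P)])) => k.
  exact: paraorthogonal_zeros.
have su k : uniq (s k) by have [] := sP k.
have s1 k : {in s k, forall z, `|z| = 1} by have [] := sP k.
have sE k : Q k = \prod_(z <- s k) ('X - z%:P) by have [] := sP k.
have ss k : size (s k) = k.+1.
  by have := Qs k; rewrite sE size_prod_XsubC => -[].
have sroot k : all (root (Q k)) (s k).
  by apply/allP => x xs; rewrite sE root_prod_XsubC.
have orth k x y : x \in s k -> y \in s k -> x != y ->
    cdot mu (node_poly (Q k) x) (node_poly (Q k) y) = 0.
  move=> xs ys xy; apply: cdot_node_poly_orth => //; last exact: s1 ys.
    exact: (allP (sroot k) _ xs).
  exact: (allP (sroot k) _ ys).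
have node0 k x : x \in s k -> node_poly (Q k) x != 0.
  by move=> xs; apply/monic_neq0/node_poly_monic => //; exact: (allP (sroot k)).
pose nrm p := (cnorm mu p)%:C%C.
pose e k x := normalized nrm (node_poly (Q k) x).
pose w k (x y : cplx R) : R := normc (e k x).[y] ^+ 2.
have nE k x y : normc (e k x).[y] ^+ 2 =
    (csqnorm (node_poly (Q k) x))^-1 * normc (node_poly (Q k) x).[y] ^+ 2.
  apply: (@complexI R); rewrite [RHS]rmorphM /= fmorphV /= -cdot_sqnorm -cnorm_sqr.
  rewrite -!mulcJE /e /normalized hornerZ rmorphM fmorphV /= cnorm_conj.
  by rewrite mulrACA -invfM -expr2.
have -> : (fun j => zero_counting R (paraorthogonal Phi (n j) (beta (n j).+1))) =
    (fun j => normalized_counting R (T := cplx R) (s (n j))).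
  apply/funext => j; apply/funext => A; rewrite -/(Q (n j)) sE.
  exact: zero_counting_simple.
have -> : (fun j => density (T := cplx R) mu
      (fun z => (n j).+1%:R^-1 * complex.Re (cCD mu Phi (n j) z z))) =
    (fun j => density (T := cplx R) mu
      (fun y => (n j).+1%:R^-1 * \sum_(x <- s (n j)) w (n j) x y)).
  apply/funext => j; congr density; apply/funext => y; congr (_ * _).
  have := node_poly_kernel cdot_linear cdotC cnorm_neq0 cnorm_conj cnorm_sqr
    Phi_monic Phi_size Phi_orth (horner_eval y) (Qm (n j)) (Qs _) (su _) (ss _)
    (sroot _) (orth _).
  rewrite /horner_eval /= => kE.
  have -> : cCD mu Phi (n j) y y = \sum_(x <- s (n j)) (w (n j) x y)%:C%C.
    transitivity (\sum_(x <- s (n j)) ((e (n j) x).[y])^* * (e (n j) x).[y]).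
      rewrite kE /cCD; apply: eq_bigr => i _.
      rewrite /normalized_OPUC /normalized. by rewrite fmorphV.
    by apply: eq_bigr => x _; rewrite mulcJE.
  by rewrite -rmorph_sum.
have cw k x : continuous (w k x) by exact: cont_sqnorm.
apply: (weak_cvg_counting_density cptK aeK (D := fun x y : cplx R => normc (x - y))
  _ _ (B := 4)) => //.
- exact: continuous_normc_dist.
- move=> f cf eps eps0.
  apply: (compact_uniform_continuity
    (D := fun x y : cplx R => normc (x - y)) cptK) => //.
  + by move=> x y z; exact: normc_distD.
  + move=> y U /nbhs_cplxP[d d0 dU]; exists d => // x xy; apply: dU.
    by rewrite normc_distC.
  + move=> y d d0; apply/nbhs_cplxP; exists d => // z.
    by rewrite normc_distC.
  + by move=> x y; rewrite normc_distC.
- by move=> k x y; rewrite sqr_ge0.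
- move=> k x xs; rewrite /w; under eq_Rintegral do rewrite nE.
  rewrite RintegralZl//; last exact: integrable_cont.
  by rewrite mulVf// gt_eqF// csqnorm_gt0// node0.
- move=> k.
  have dE x : x \in s k ->
      \int[mu]_(y in [set: borelType (cplx R)]) (normc (x - y) ^+ 2 * w k x y) =
      csqnorm (Q k) * (csqnorm (node_poly (Q k) x))^-1.
    move=> xs; rewrite mulrC {2}/csqnorm -RintegralZl//; last exact: integrable_cont.
    apply: eq_Rintegral => y _; rewrite /w nE mulrCA; congr (_ * _).
    rewrite {2}(node_polyK (allP (sroot k) x xs)) hornerM normcM exprMn.
    by rewrite hornerXsubC normc_distC.
  rewrite big_seq; under eq_bigr => x xs do rewrite dE//.
  rewrite -mulr_sumr -big_seq.
  have -> : \sum_(x <- s k) (csqnorm (node_poly (Q k) x))^-1 = (csqnorm (Phi k))^-1.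
    apply: (@complexI R); rewrite rmorph_sum /= [RHS]fmorphV /= -cdot_sqnorm.
    rewrite -(node_poly_leading cdot_linear cdotC cnorm_neq0 cnorm_conj cnorm_sqr
      Phi_monic Phi_size Phi_orth (Qm k) (Qs k) (su k) (ss k) (sroot k) (orth k)).
    by apply: eq_bigr => x _; rewrite cdot_sqnorm -fmorphV.
  rewrite ler_pdivrMr; last by rewrite csqnorm_gt0// monic_neq0.
  exact: csqnorm_paraorthogonal.
Qed.

End unit_circle.

(** * Comparison of zero counting measures and Christoffel-Darboux kernels *)

Theorem theorem1p5 (R : realType) (n : nat -> nat)
    (n_gt0 : forall j, (0 < n j)%N)
    (n_incr : {homo n : i j / (i < j)%N}) :
  (forall (mu : {finite_measure set (borelType R) -> \bar R})
      (nu_oo : {finite_measure set (borelType R) -> \bar R})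
      (P : nat -> {poly R}),
    bounded_set (msupport mu) -> infinite_set (msupport mu) ->
    monic_OPRL mu P ->
    (weak_cvg (fun j => zero_counting R (P (n j).+1)) nu_oo
     <->
     weak_cvg
       (fun j => density mu (fun x => (n j).+1%:R^-1 * rCD mu P (n j) x x))
       nu_oo))
  /\
  (forall (mu : {finite_measure set (borelType (cplx R)) -> \bar R})
      (nu_oo : {finite_measure set (borelType (cplx R)) -> \bar R})
      (Phi : nat -> {poly R[i]}) (beta : nat -> R[i]),
    mu (~` unit_circle R) = 0%E -> nu_oo (~` unit_circle R) = 0%E ->
    infinite_set (msupport mu) ->
    monic_OPUC mu Phi ->
    (forall k, `|beta k| = 1) ->
    (weak_cvg (T := cplx R)
       (fun j => zero_counting R (paraorthogonal Phi (n j) (beta (n j).+1)))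
       nu_oo
     <->
     weak_cvg (T := cplx R)
       (fun j => density mu
          (fun z => (n j).+1%:R^-1 * complex.Re (cCD mu Phi (n j) z z)))
       nu_oo)).
Proof.
split=> [mu l P bs infs OP|mu l Phi beta mu0 l0 infs OP beta1].
  have [M M0 aeM] := ae_bounded_of_msupport bs.
  exact: (weak_cvg_OPRL M0 aeM infs OP l n_incr).
exact: (weak_cvg_OPUC mu0 infs OP l n_incr beta1).
Qed.
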